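(* Let $\mathcal{U}$ be a Hilbert space, $\mathbb{J}\subset\mathbb{Z}$, $\{\mathcal{V}_j: j\in\mathbb{J}\}$ a sequence of Hilbert spaces, $\{\Lambda_j\in\mathcal{L}(\mathcal{U},\mathcal{V}_j): j\in\mathbb{J}\}$ a g-frame for $\mathcal{U}$ with respect to $\{\mathcal{V}_j: j\in\mathbb{J}\}$, and $\{\tilde\Lambda_j: j\in\mathbb{J}\}$ its canonical dual g-frame. Then for every bounded linear operator $T$ on $\mathcal{U}$, $$T=\sum_{j\in\mathbb{J}}T\Lambda_j^*\tilde\Lambda_j=\sum_{j\in\mathbb{J}}T\tilde\Lambda_j^*\Lambda_j=\sum_{j\in\mathbb{J}}\Lambda_j^*\tilde\Lambda_jT=\sum_{j\in\mathbb{J}}\tilde\Lambda_j^*\Lambda_jT,$$ where the series converge in the weak* sense.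
   Context: $\mathcal{L}(\mathcal{U},\mathcal{V}_j)$ is the space of bounded linear operators from $\mathcal{U}$ to $\mathcal{V}_j$. A sequence $\{\Lambda_j\in\mathcal{L}(\mathcal{U},\mathcal{V}_j): j\in\mathbb{J}\}$ is a g-frame for $\mathcal{U}$ with respect to $\{\mathcal{V}_j\}$ if there are $A,B>0$ with $A\|f\|^2\le\sum_{j\in\mathbb{J}}\|\Lambda_jf\|^2\le B\|f\|^2$ for all $f\in\mathcal{U}$. Its g-frame operator $Sf=\sum_{j\in\mathbb{J}}\Lambda_j^*\Lambda_jf$ is bounded and invertible on $\mathcal{U}$, and its canonical dual g-frame is $\tilde\Lambda_j=\Lambda_jS^{-1}$, $j\in\mathbb{J}$. Weak* convergence is in the space of bounded operators on $\mathcal{U}$, regarded as the dual of the trace class operators; series over $\mathbb{J}$ are limits of the partial sums over $j\in\mathbb{J}$, $n_1\le j\le n_2$. *)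

(* Defs.v *)
From HB Require Import structures.
From mathcomp Require Import all_boot all_order all_algebra sesquilinear.
From mathcomp Require Import all_classical all_reals all_analysis.
From mathcomp Require Import finmap complex.
From mathcomp.analysis.showcase Require summability.

Set Implicit Arguments.
Unset Strict Implicit.
Unset Printing Implicit Defensive.

Import Order.TTheory GRing.Theory Num.Theory.
Import numFieldNormedType.Exports.

Local Open Scope classical_set_scope.
Local Open Scope ring_scope.

(* The scalar field of a Hilbert space, with its conjugation: the real or the
   complex numbers. *)
Variant hilbert_scalars (R : realType) :
    forall K : numFieldType, (K -> K) -> Prop :=
  | real_scalars : @hilbert_scalars R (R : numFieldType) idfun
  | complex_scalars : @hilbert_scalars R (R[i] : numFieldType) Num.conj.

(* [inner] is linear in its first argument and conjugate-linear in the
   second. *)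
HB.mixin Record CompleteNormedModule_isHilbert
    (K : numFieldType) (conj : K -> K) U of CompleteNormedModule K U := {
  inner : {dot U for conj};
  inner_norm : forall x : U, inner x x = `|x| ^+ 2
}.

#[short(type="hilbertType")]
HB.structure Definition Hilbert (K : numFieldType) (conj : K -> K) :=
  {U of CompleteNormedModule K U & CompleteNormedModule_isHilbert K conj U}.

Section Operators.
Variables (K : numFieldType) (conj : K -> K).
Implicit Types U V : hilbertType conj.

Definition bounded_operator U V (f : U -> V) : Prop :=
  linear f /\ exists M : K, forall x, `|f x| <= M * `|x|.

(* For a bounded operator f, the vector z below exists by the Riesz
   representation theorem, and it is unique. *)
Definition adjoint U V (f : U -> V) (y : V) : U :=
  get [set z | forall x, inner (f x) y = inner x z].

(* Used for bijective f only. *)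
Definition inverse_operator U V (f : U -> V) (y : V) : U :=
  get [set x | f x = y].

(* Over the reals, selfadjointness does not follow from the second clause. *)
Definition positive_operator U (P : U -> U) : Prop :=
  (forall x y, inner (P x) y = inner x (P y)) /\
  (forall x, 0 <= inner (P x) x).

(* The positive square root of A^* A. *)
Definition absolute_value U (A : U -> U) : U -> U :=
  get [set P : U -> U | [/\ bounded_operator P, positive_operator P &
                          P \o P = adjoint A \o A]].

Definition orthonormal_set U (E : set U) : Prop :=
  forall x y, E x -> E y -> inner x y = (x == y)%:R.

Definition orthonormal_basis U (E : set U) : Prop :=
  orthonormal_set E /\
  forall F : set U, orthonormal_set F -> E `<=` F -> F = E.

(* The sums over E are unordered: they are limits along the finite subsets
   of E, so that E may be uncountable. *)
Definition diagonal_sums U (E : set U) (A : U -> U) : {fset U} -> K^o :=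
  summability.partial_sum ((fun e => inner (A e) e : K^o) \_ E).

Definition trace U (E : set U) (A : U -> U) : K :=
  lim (diagonal_sums E A @ summability.totally).

(* The terms of this sum are nonnegative, hence it converges if and only if it
   is finite. *)
Definition trace_class U (E : set U) (A : U -> U) : Prop :=
  bounded_operator A /\
  cvg (diagonal_sums E (absolute_value A) @ summability.totally).

(* Convergence in the weak* topology of the space of bounded operators on U,
   where T is identified with the functional A |-> trace (T \o A) on trace class
   operators. Neither [trace_class E A] nor the traces below depend on the
   orthonormal basis E. *)
Definition weakstar_cvg U (I : Type) (F : set_system I)
    (T_ : I -> U -> U) (T : U -> U) : Prop :=
  [/\ forall i, bounded_operator (T_ i), bounded_operator T &
      forall (E : set U) (A : U -> U),
        orthonormal_basis E -> trace_class E A ->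
        trace E (T_ i \o A) @[i --> F] --> (trace E (T \o A) : K^o)].

End Operators.

Definition partial_sums (M : nmodType) (J : set int) (F : int -> M)
    (n : nat * nat) : M :=
  \sum_(j \in J `&` [set j : int | - n.1%:Z <= j <= n.2%:Z]) F j.

(* The two ends of the range of summation go to infinity independently. *)
Definition both_ends : set_system (nat * nat) := filter_prod \oo \oo.

(* The families V and L are indexed by all integers, but only their members at
   indices in J matter. *)
Section GFrames.
Variables (K : numFieldType) (conj : K -> K) (U : hilbertType conj).
Variables (J : set int) (V : int -> hilbertType conj).
Variable L : forall j, U -> V j.

(* For K complex, 0 < A means that A is real and positive, so the inequalities
   below are between real numbers. *)
Definition gframe : Prop :=
  (forall j, J j -> bounded_operator (L j)) /\
  exists A B : K, [/\ 0 < A, 0 < B & forall f : U,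
    exists2 s : K,
      partial_sums J (fun j => `|L j f| ^+ 2 : K^o) @ both_ends --> (s : K^o) &
      A * `|f| ^+ 2 <= s <= B * `|f| ^+ 2].

Definition frame_operator (f : U) : U :=
  lim (partial_sums J (fun j => adjoint (L j) (L j f)) @ both_ends).

Definition canonical_dual (j : int) : U -> V j :=
  L j \o inverse_operator frame_operator.

Definition weakstar_series (F : int -> U -> U) (T : U -> U) : Prop :=
  weakstar_cvg both_ends (partial_sums J F) T.

End GFrames.

(* Main.v *)
Require Import Defs.
From HB Require Import structures.
From mathcomp Require Import all_boot all_order all_algebra sesquilinear.
From mathcomp Require Import all_classical all_reals all_analysis.
From mathcomp Require Import finmap complex ring zify.
From mathcomp.analysis.showcase Require summability.

Set Implicit Arguments.
Unset Strict Implicit.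
Unset Printing Implicit Defensive.

Import Order.TTheory GRing.Theory Num.Theory.
Import numFieldNormedType.Exports.

Local Open Scope classical_set_scope.
Local Open Scope ring_scope.

(** Write [S_n] for the partial sum of [L_j^* L_j] over the window of indices
    [n], and [S] for the frame operator.  The upper frame bound [B] gives
    [|S_n f| <= B |f|] and makes [S_n f] a Cauchy family as soon as the scalar
    sums of [|L_j f|^2] converge ([synthesis_le]), so [S_n] tends to [S]
    strongly.  The lower bound [A] makes the selfadjoint operator [S] coercive,
    hence invertible with [|S^-1| <= A^-1], and the adjoint of [L_j S^-1] is
    [S^-1 L_j^*] for [j] in [J].  The partial sums of the four series are
    therefore [T S_n S^-1], [T S^-1 S_n], [S_n S^-1 T] and [S^-1 S_n T]: they
    are uniformly bounded and tend to [T] strongly.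

    It remains to see that bounded strong convergence [T_i --> T] implies weak*
    convergence ([strong_weakstar_cvg]).  Each sum of [<T_i A e, e>] over a
    finite part of the basis converges, so it suffices that for a trace class
    operator [A] the tails of the sums of [<X A e, e>] are small uniformly over
    the operators [X] of norm at most [C] ([uniform_tails]).  Let [P] be the
    absolute value of [A] and [Q] a square root of [P].  If [A = W P] with
    [|W| <= 1], then [<X A e, e> = <Q e, (X W Q)^* e>], which is at most
    [t |Q e|^2 + t^-1 |(X W Q)^* e|^2] up to the factor 2.  The sum of
    [|Q e|^2 = <P e, e>] has small tails, and the sum of [|(X W Q)^* e|^2] is
    at most [C^2] times the trace of [P], because the Hilbert-Schmidt norm is
    the same for an operator and its adjoint ([sum_sqr_adjoint_le]).  In place
    of the polar decomposition, [sum_inner_le] uses the contractions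
    [W = A (P + eps)^-1], for which [A = W (P + eps)], and lets [eps] tend to
    0.

    Three facts on Hilbert spaces rest on the minimization argument of
    [projection]: the Riesz representation ([Riesz], whence adjoints exist), the
    surjectivity of coercive selfadjoint operators ([coercive_surj]), and
    Parseval's identity for a maximal orthonormal set ([Parseval_approx]).
    Square roots of positive operators are limits of the iteration
    [Y := (D + Y^2) / 2] ([positive_sqrt]). *)

(** * Real and complex scalars *)

(** The facts on the real and the complex numbers that the proof needs, in a form
    that does not mention the two cases.  Completeness of the scalars enters only
    as the existence of infima of sets of nonnegative elements, since in the
    complex case the order is partial and only real elements are comparable. *)
Record scalar_axioms (K : numFieldType) (conj : K -> K) : Prop := {
  conj_normE : forall x, x * conj x = `|x| ^+ 2;
  add_conj_real : forall x, x + conj x \is Num.real;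
  conj_involutive : involutive conj;
  nonneg_inf : forall S : set K, S !=set0 -> S `<=` [set x | 0 <= x] ->
    exists2 d : K, (forall x, S x -> d <= x) &
      forall e, 0 < e -> exists2 x, S x & x < d + e }.

Lemma hilbert_scalars_axioms (R : realType) (K : numFieldType) (conj : K -> K) :
  hilbert_scalars R conj -> scalar_axioms conj.
Proof.
case.
- split.
  + by move=> x; rewrite /= real_normK ?num_real// expr2.
  + by move=> x; apply: num_real.
  + by [].
  + move=> S S0 Spos; have lbS : lbound S 0 by move=> x /Spos.
    have hS : has_inf S by split=> //; exists 0.
    exists (inf S) => [x Sx|e e0]; first by apply: ge_inf => //; exists 0.
    by have [x Sx xe] := inf_adherent e0 hS; exists x.
- split.
  + by move=> x; rewrite normCK.
  + move=> x; rewrite CrealE rmorphD /= conjCK addrC; exact: eqxx.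
  + exact: conjCK.
  + move=> S [s Ss] Spos.
    have SE x : S x -> x = ((complex.Re x)%:C)%C.
      by move=> /Spos x0; rewrite RRe_real// ger0_real.
    pose S' := [set r : R | S (r%:C)%C].
    have S'pos x : S' x -> 0 <= x by move=> /Spos /=; rewrite ler0c.
    have lbS : lbound S' 0 by move=> x /S'pos.
    have S'0 : S' !=set0 by exists (complex.Re s); rewrite /S'/= -SE.
    have hS : has_inf S' by split=> //; exists 0.
    exists ((inf S')%:C)%C => [x Sx|e e0].
      by rewrite (SE _ Sx) lecR; apply: ge_inf => //; [exists 0|rewrite /S'/= -SE].
    have eE : e = ((complex.Re e)%:C)%C.
      by rewrite RRe_real// gtr0_real.
    have e0' : 0 < complex.Re e by rewrite -ltcR -eE.
    have [x Sx xe] := inf_adherent e0' hS; exists (x%:C)%C => //.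
    by rewrite eE -rmorphD /= ltcR.
Qed.

(** * Inner products, Cauchy-Schwarz and projections *)

Section InnerProduct.
Variables (K : numFieldType) (conj : K -> K).
Implicit Types U V : hilbertType conj.

Lemma innerDl U (x y z : U) : inner (x + y) z = inner x z + inner y z.
Proof. by rewrite linearDl. Qed.
Lemma innerDr U (x y z : U) : inner z (x + y) = inner z x + inner z y.
Proof. by rewrite linearDr. Qed.
Lemma innerBl U (x y z : U) : inner (x - y) z = inner x z - inner y z.
Proof. by rewrite linearBl. Qed.
Lemma innerBr U (x y z : U) : inner z (x - y) = inner z x - inner z y.
Proof. by rewrite linearBr. Qed.
Lemma innerZl U a (x z : U) : inner (a *: x) z = a * inner x z.
Proof. by rewrite linearZl_LR. Qed.
Lemma innerZr U a (x z : U) : inner z (a *: x) = conj a * inner z x.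
Proof. by rewrite linearZr_LR. Qed.
Lemma inner0l U (z : U) : inner 0 z = 0.
Proof. by rewrite linear0l. Qed.
Lemma inner0r U (z : U) : inner z 0 = 0.
Proof. by rewrite linear0r. Qed.
Lemma innerC U (x y : U) : inner y x = conj (inner x y).
Proof. by rewrite [LHS]hermitian_subproof expr0 mul1r. Qed.
Lemma inner_suml U (I : Type) (r : seq I) (P : pred I) (F : I -> U) z :
  inner (\sum_(i <- r | P i) F i) z = \sum_(i <- r | P i) inner (F i) z.
Proof. by rewrite linear_sumlz. Qed.
Lemma inner_sumr U (I : Type) (r : seq I) (P : pred I) (F : I -> U) z :
  inner z (\sum_(i <- r | P i) F i) = \sum_(i <- r | P i) inner z (F i).
Proof. by rewrite linear_sumr. Qed.
End InnerProduct.

Section OrderedField.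
Variable K : numFieldType.
Implicit Types a b c e t : K.

(** The form in which approximation arguments are concluded: the error term may
    carry any fixed nonnegative factor. *)
Lemma ler_eps (C a b : K) : 0 <= C ->
  (forall e, 0 < e -> a <= b + C * e) -> a <= b.
Proof.
move=> C0 H; apply/ler_addgt0Pr => e e0.
have C1 : 0 < C + 1 by rewrite ltr_wpDl.
apply: le_trans (H (e / (C + 1)) _) _; first by rewrite divr_gt0.
rewrite lerD2l mulrCA ler_piMr ?(ltW e0)// ler_pdivrMr// mul1r lerDl//.
Qed.

Lemma ltr_common a b : 0 < a -> 0 < b ->
  exists c, [/\ 0 < c, c <= a & c <= b].
Proof.
move=> a0 b0; case: (real_leP (gtr0_real a0) (gtr0_real b0)) => h.
  by exists a; split.
by exists b; split=> //; apply: ltW.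
Qed.

Lemma ler_of_sqr a b : 0 <= a -> 0 <= b -> a ^+ 2 <= b ^+ 2 -> a <= b.
Proof. by move=> a0 b0; rewrite ler_pXn2r. Qed.

(** The difference of the two sides is [t^-1 (t a - b)^2]. *)
Lemma young_le t a b : 0 < t -> 0 <= a -> 0 <= b ->
  2 * (a * b) <= t * a ^+ 2 + t^-1 * b ^+ 2.
Proof.
move=> t0 a0 b0; rewrite -subr_ge0.
have -> : t * a ^+ 2 + t^-1 * b ^+ 2 - 2 * (a * b) = t^-1 * (t * a - b) ^+ 2.
  by field; rewrite gt_eqF.
rewrite mulr_ge0 ?invr_ge0 ?(ltW t0)// -realEsqr rpredB// ger0_real// mulr_ge0//.
exact: ltW.
Qed.
End OrderedField.

Section Scalars.
Variables (K : numFieldType) (conj : K -> K).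
Hypothesis HK : scalar_axioms conj.

Lemma conj_norm x : `|conj x| = `|x|.
Proof.
apply/eqP; rewrite -(@eqrXn2 _ 2)// -(conj_normE HK) (conj_involutive HK) mulrC.
by rewrite (conj_normE HK).
Qed.

Lemma conj_nneg x : 0 <= x -> conj x = x.
Proof.
rewrite le_eqVlt => /orP[/eqP<-|x0].
  by apply/eqP; rewrite -normr_eq0 conj_norm normr0.
apply: (mulfI (lt0r_neq0 x0)); rewrite (conj_normE HK) gtr0_norm// expr2//.
Qed.

Section Norm.
Variable U : hilbertType conj.
Implicit Types x y : U.

Lemma sqr_normD x y : `|x + y| ^+ 2 =
  `|x| ^+ 2 + `|y| ^+ 2 + (inner x y + conj (inner x y)).
Proof.
rewrite -!inner_norm innerDl !innerDr -innerC; ring.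
Qed.

Lemma sqr_normB x y : `|x - y| ^+ 2 =
  `|x| ^+ 2 + `|y| ^+ 2 - (inner x y + conj (inner x y)).
Proof.
rewrite -!inner_norm innerBl !innerBr -innerC; ring.
Qed.

Lemma parallelogram x y :
  `|x - y| ^+ 2 = 2 * `|x| ^+ 2 + 2 * `|y| ^+ 2 - `|x + y| ^+ 2.
Proof. rewrite sqr_normB sqr_normD; ring. Qed.

(** The squared norm of [|y|^2 x - <x, y> y] is nonnegative. *)
Lemma inner_norm_le x y : `|inner x y| <= `|x| * `|y|.
Proof.
have [->|y0] := eqVneq y 0; first by rewrite inner0r !normr0 mulr0.
have n0 : 0 < `|y| ^+ 2 by rewrite exprn_gt0 ?normr_gt0.
apply: ler_of_sqr; rewrite ?mulr_ge0// exprMn -subr_ge0.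
rewrite -(pmulr_rge0 _ n0); set w := `|y| ^+ 2 *: x - inner x y *: y.
suff <- : inner w w = `|y| ^+ 2 * (`|x| ^+ 2 * `|y| ^+ 2 - `|inner x y| ^+ 2).
  by rewrite inner_norm exprn_ge0.
have wy : inner w y = 0.
  by rewrite /w innerBl !innerZl inner_norm mulrC subrr.
rewrite {2}/w innerBr !innerZr wy mulr0 subr0 conj_nneg ?exprn_ge0//.
rewrite /w innerBl !innerZl inner_norm (innerC x y) -(conj_normE HK); ring.
Qed.

Lemma inner_eq0 x : (forall y, inner x y = 0) -> x = 0.
Proof.
by move=> /(_ x); rewrite inner_norm => /eqP; rewrite expf_eq0 normr_eq0 => /eqP.
Qed.

Lemma inner_extl x x' : (forall y, inner x y = inner x' y) -> x = x'.
Proof.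
by move=> H; apply/eqP; rewrite -subr_eq0; apply/eqP/inner_eq0 => y; rewrite innerBl H subrr.
Qed.

Lemma inner_extr x x' : (forall y, inner y x = inner y x') -> x = x'.
Proof. by move=> H; apply: inner_extl => y; rewrite innerC H -innerC. Qed.
End Norm.

(** Completeness for a nested family of approximate solutions [P e], indexed by
    the precision [e]; it avoids choosing sequences. *)
Lemma nested_limit (U : completeNormedModType K) (P : K -> set U) :
  (forall e, 0 < e -> P e !=set0) ->
  (forall e e', 0 < e -> e <= e' -> P e `<=` P e') ->
  (forall eta, 0 < eta -> exists2 e, 0 < e &
     forall u v, P e u -> P e v -> `|u - v| <= eta) ->
  exists x, forall eta, 0 < eta -> exists2 e, 0 < e &
     forall u, P e u -> `|x - u| <= eta.
Proof.
move=> P0 Pmono Pdiam; pose F := filter_from [set e | 0 < e] P.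
have FF : ProperFilter F.
  apply: filter_from_proper => //; apply: filter_from_filter; first by exists 1 => /=.
  move=> i j /= i0 j0; have [c [c0 ci cj]] := ltr_common i0 j0.
  by exists c => //= u Pu; split; [apply: Pmono ci _ _|apply: Pmono cj _ _].
have Fcvg : cvg F.
  apply: cauchy_cvg; apply: cauchy_exP => eps eps0.
  have [|e e0 He] := Pdiam (eps / 2); first by rewrite divr_gt0.
  have [u Pu] := P0 _ e0; exists u; exists e => //= v Pv.
  rewrite -ball_normE /=; apply: le_lt_trans (He _ _ Pu Pv) _.
  by rewrite ltr_pdivrMr// ltr_pMr// ltr1n.
exists (lim F) => eta eta0; have eta2 : 0 < eta / 2 by rewrite divr_gt0.
have [e e0 He] := Pdiam _ eta2; exists e => // u Pu.
have /cvgrPdist_le /(_ _ eta2) [e' /= e'0 He'] : id @ F --> lim F by [].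
have [c [c0 ce ce']] := ltr_common e0 e'0; have [v Pv] := P0 _ c0.
rewrite (le_trans (ler_distD v _ _))// [leRHS]splitr lerD//.
  by apply: He'; apply: Pmono ce' _ _.
by apply: He => //; apply: Pmono ce _ _.
Qed.

(** The family of [m] in [M] with [|y - m|^2 < d + e], where [d] is the infimum
    of [|y - m|^2], has small diameters by the parallelogram identity; its limit
    [x] is the nearest point to [y] in the closure of [M].  The subspace [M] is
    not assumed closed, so [x] is only approximated by elements of [M]. *)
Lemma projection (U : hilbertType conj) (M : set U) (y : U) : M 0 ->
  (forall a u v, M u -> M v -> M (a *: u + v)) ->
  exists x, (forall eta, 0 < eta -> exists2 m, M m & `|x - m| <= eta) /\
            (forall m, M m -> inner (y - x) m = 0).
Proof.
move=> M0 Mlin.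
have [|_ [m Mm <-]|d dle dinf] :=
  nonneg_inf HK (S := [set `|y - m| ^+ 2 | m in M]).
- by exists (`|y - 0| ^+ 2), 0.
- by rewrite /= exprn_ge0.
have dM m : M m -> d <= `|y - m| ^+ 2 by move=> Mm; apply: dle; exists m.
pose P e := [set m | M m /\ `|y - m| ^+ 2 < d + e].
have P0 e : 0 < e -> P e !=set0.
  by move=> e0; have [_ [m Mm <-] lt] := dinf _ e0; exists m.
have Pmono e e' : 0 < e -> e <= e' -> P e `<=` P e'.
  move=> _ ee' m [Mm mlt]; split=> //; apply: lt_le_trans mlt _.
  by rewrite lerD2l.
have Pdiam eta : 0 < eta -> exists2 e, 0 < e &
     forall u v, P e u -> P e v -> `|u - v| <= eta.
  move=> eta0; exists (eta ^+ 2 / 4); first by rewrite divr_gt0 ?exprn_gt0.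
  move=> u v [Mu ult] [Mv vlt]; apply: ler_of_sqr; rewrite ?(ltW eta0)//.
  have -> : u - v = (y - v) - (y - u) by rewrite opprB [RHS]addrC addrA subrK.
  rewrite parallelogram.
  (* (u + v) / 2 lies in M, hence is at distance at least sqrt d from y. *)
  have -> : y - v + (y - u) = (2 : K) *: (y - (2^-1 *: u + (2^-1 *: v + 0))).
    rewrite addr0 scalerBr scalerDr !scalerA divff ?pnatr_eq0// !scale1r.
    rewrite scaler_nat mulr2n opprD addrACA (addrC (- u)); congr (_ + _).
  rewrite normrZ exprMn ger0_norm//.
  have h : d <= `|y - (2^-1 *: u + (2^-1 *: v + 0))| ^+ 2.
    by apply: dM; apply: (Mlin) => //; apply: Mlin.
  rewrite lerBlDr; apply: (@le_trans _ _ (2 * (d + eta ^+ 2 / 4) + 2 * (d + eta ^+ 2 / 4))).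
    by apply: lerD; apply: ler_wpM2l => //; apply: ltW.
  have -> : 2 * (d + eta ^+ 2 / 4) + 2 * (d + eta ^+ 2 / 4) = eta ^+ 2 + 2 ^+ 2 * d by field.
  by rewrite lerD2l ler_wpM2l// exprn_ge0.
have [x Hx] := nested_limit P0 Pmono Pdiam.
exists x; split=> [eta eta0|m Mm].
  by have [e e0 He] := Hx _ eta0; have [m Pm] := P0 _ e0; exists m; [case: Pm|apply: He].
apply/eqP; rewrite -normr_le0; apply: (@ler_eps _ (2 * `|m|)) => [|eta eta0].
  by rewrite mulr_ge0.
have [m0|mn0] := eqVneq m 0; first by rewrite m0 inner0r !normr0 mulr0 mul0r add0r.
have m2 : 0 < `|m| ^+ 2 by rewrite exprn_gt0 ?normr_gt0.
have [e1 e10 He1] := Hx _ eta0.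
have [e [e0 ee1 eeta]] := ltr_common e10 (exprn_gt0 2 eta0).
have [u Pu] := P0 _ e0.
have -> : y - x = (y - u) - (x - u) by rewrite opprB addrA subrK.
rewrite innerBl; apply: le_trans (ler_normB _ _) _.
rewrite add0r mulrAC mulrDl mul1r mulrDl; apply: lerD; last first.
  apply: le_trans (inner_norm_le _ _) _; apply: ler_wpM2r => //; apply: He1.
  exact: Pmono ee1 _ _.
apply: ler_of_sqr; rewrite ?mulr_ge0 ?(ltW eta0)//.
case: Pu => Mu ult; set w := y - u in ult *.
(* The coefficient a minimizes the norm of w - a m; the minimum cannot be below d. *)
pose a := inner w m / `|m| ^+ 2.
have /dM : M (a *: m + u) by apply: Mlin.
have -> : y - (a *: m + u) = w - a *: m by rewrite /w opprD addrA addrAC.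
rewrite sqr_normB normrZ exprMn innerZr.
have wmE : inner w m = a * `|m| ^+ 2 by rewrite /a divfK// gt_eqF.
have -> : conj a * inner w m = (`|a| * `|m|) ^+ 2.
  by rewrite wmE mulrA (mulrC (conj a)) (conj_normE HK) exprMn.
rewrite conj_nneg ?exprn_ge0 ?mulr_ge0// -exprMn addrKA => dw.
rewrite wmE normrM (ger0_norm (exprn_ge0 _ _))//.
have -> : `|a| * `|m| ^+ 2 = `|a| * `|m| * `|m| by rewrite expr2 mulrA.
rewrite [leLHS]exprMn [leRHS]exprMn.
rewrite ler_wpM2r ?exprn_ge0//; apply: le_trans eeta.
by rewrite -(lerD2l d); apply: ltW; apply: le_lt_trans ult; rewrite -lerBrDr.
Qed.
End Scalars.

(** * Bounded operators, adjoints and coercive inverses *)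

Section Limits.
Variable K : numFieldType.

Lemma cvg_norm_le (V : normedModType K) (T : Type) (F : set_system T)
    {FF : ProperFilter F} (f : T -> V) (l : V) (C : K) :
  f @ F --> l -> (\forall x \near F, `|f x| <= C) -> `|l| <= C.
Proof.
move=> /cvgrPdist_le fl fC; apply/ler_addgt0Pl => e e0.
have [x [h1 h2]] := filter_ex (filterI (fl e e0) fC).
by rewrite -(subrK (f x) l); apply: le_trans (ler_normD _ _) _; apply: lerD.
Qed.

Lemma lim_ext (V : normedModType K) (T : Type) (F : set_system T)
    {FF : ProperFilter F} (f g : T -> V) (l l' : V) :
  f @ F --> l -> g @ F --> l' -> f =1 g -> l = l'.
Proof.
by move=> fl gl /funext fg; rewrite fg in fl; exact: norm_cvg_unique fl gl.
Qed.
End Limits.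

Section LinearOps.
Variables (K : numFieldType) (U V : lmodType K) (f : U -> V).
Hypothesis lf : linear f.

Let F : {linear U -> V} := HB.pack f (GRing.isLinear.Build _ _ _ _ f lf).

Lemma linop0 : f 0 = 0. Proof. exact: (linear0 F). Qed.
Lemma linopD x y : f (x + y) = f x + f y. Proof. exact: (linearD F). Qed.
Lemma linopB x y : f (x - y) = f x - f y. Proof. exact: (linearB F). Qed.
Lemma linopZ a x : f (a *: x) = a *: f x.
Proof. by have := lf a x 0; rewrite !addr0 linop0 addr0. Qed.
Lemma linop_sum (I : Type) (r : seq I) (P : pred I) (g : I -> U) :
  f (\sum_(i <- r | P i) g i) = \sum_(i <- r | P i) f (g i).
Proof. exact: (linear_sum F). Qed.
End LinearOps.

Section Ops.
Variables (K : numFieldType) (conj : K -> K).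
Hypothesis HK : scalar_axioms conj.
Implicit Types U V W : hilbertType conj.

Definition bounded_by U V (C : K) (f : U -> V) :=
  linear f /\ forall x, `|f x| <= C * `|x|.

Lemma bounded_operatorP U V (f : U -> V) :
  bounded_operator f <-> exists2 C, 0 < C & bounded_by C f.
Proof.
split=> [[lf [M HM]]|[C _ [lf HC]]]; last by split=> //; exists C.
exists (`|M| + 1); first by rewrite ltr_wpDl.
split=> // x; rewrite mulrDl mul1r ler_wpDr//.
apply: le_trans (HM x) _; have M0 : 0 <= M * `|x| by apply: le_trans (HM x).
by rewrite -(ger0_norm M0) normrM normr_id.
Qed.

Lemma bounded_by_operator U V C (f : U -> V) : bounded_by C f -> bounded_operator f.
Proof. by case=> lf HC; split=> //; exists C. Qed.

Lemma bounded_by_comp U V W C D (f : V -> W) (g : U -> V) : 0 <= C ->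
  bounded_by C f -> bounded_by D g -> bounded_by (C * D) (f \o g).
Proof.
move=> C0 [lf Hf] [lg Hg]; split=> [a x y|x] /=; first by rewrite lg lf.
by apply: le_trans (Hf _) _; rewrite -mulrA ler_wpM2l.
Qed.

Lemma bounded_comp U V W (f : V -> W) (g : U -> V) :
  bounded_operator f -> bounded_operator g -> bounded_operator (f \o g).
Proof.
move=> /bounded_operatorP[C C0 Hf] /bounded_operatorP[D D0 Hg].
exact: (bounded_by_operator (bounded_by_comp (ltW C0) Hf Hg)).
Qed.

Lemma bounded_cvg U V (f : U -> V) (T : Type) (F : set_system T)
    {FF : Filter F} (g : T -> U) (l : U) :
  bounded_operator f -> g @ F --> l -> (fun t => f (g t)) @ F --> f l.
Proof.
move=> /bounded_operatorP[C C0 [lf Hf]] /cvgrPdist_le gl; apply/cvgrPdist_le => e e0.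
near=> t; rewrite -linopB//; apply: le_trans (Hf _) _.
rewrite -ler_pdivlMl//; near: t; apply: gl; by rewrite mulr_gt0 ?invr_gt0.
Unshelve. all: by end_near. Qed.

Lemma inner_cvg U (T : Type) (F : set_system T) {FF : Filter F} (g : T -> U)
    (l y : U) :
  g @ F --> l -> (fun t => inner (g t) y : K^o) @ F --> (inner l y : K^o).
Proof.
move=> /cvgrPdist_le gl; apply/cvgrPdist_le => e e0.
near=> t; rewrite -innerBl; apply: le_trans (inner_norm_le HK _ _) _.
apply: (@le_trans _ _ (`|l - g t| * (`|y| + 1))); first by rewrite ler_wpM2l// lerDl.
rewrite -ler_pdivlMr ?ltr_wpDl//; near: t; apply: gl.
by rewrite divr_gt0 ?ltr_wpDl.
Unshelve. all: by end_near. Qed.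

Lemma inner_cvgr U (T : Type) (F : set_system T) {FF : Filter F} (g : T -> U)
    (l y : U) :
  g @ F --> l -> (fun t => inner y (g t) : K^o) @ F --> (inner y l : K^o).
Proof.
move=> /cvgrPdist_le gl; apply/cvgrPdist_le => e e0.
near=> t; rewrite -innerBr; apply: le_trans (inner_norm_le HK _ _) _.
apply: (@le_trans _ _ ((`|y| + 1) * `|l - g t|)); first by rewrite ler_wpM2r// lerDl.
rewrite -ler_pdivlMl ?ltr_wpDl//; near: t; apply: gl.
by rewrite mulr_gt0 ?invr_gt0 ?ltr_wpDl.
Unshelve. all: by end_near. Qed.

Arguments inner_cvg {U T F FF g l} y _.
Arguments inner_cvgr {U T F FF g l} y _.

(** A vector [w] orthogonal to the kernel of [g], given by [projection] applied
    to a vector outside the kernel, represents [g] up to a scalar. *)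
Lemma Riesz U (g : U -> K) (C : K) : 0 < C ->
  (forall a x y, g (a *: x + y) = a * g x + g y) ->
  (forall x, `|g x| <= C * `|x|) -> exists z, forall x, g x = inner x z.
Proof.
move=> C0 lg Hg.
have lg' : linear (g : U -> K^o) by [].
have [g0|/existsNP[y /eqP gy]] := pselect (forall x, g x = 0).
  by exists 0 => x; rewrite inner0r.
have [|a u v|x [xM xo]] := projection HK (M := [set x | g x = 0]) y.
- exact: (linop0 lg').
- by rewrite /= lg => -> ->; rewrite mulr0 addr0.
have gx : g x = 0.
  apply/eqP; rewrite -normr_le0; apply: (@ler_eps _ C); rewrite ?(ltW C0)//.
  move=> e e0; rewrite add0r; have [m gm Hm] := xM e e0.
  have -> : g x = g (x - m) by rewrite (linopB lg') gm subr0.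
  by apply: le_trans (Hg _) _; rewrite ler_pM2l.
set w := y - x in xo.
have gw : g w != 0 by rewrite /w (linopB lg') gx subr0.
have w0 : `|w| ^+ 2 != 0.
  rewrite expf_eq0 /= normr_eq0; apply: contra_neq gw => ->; exact: (linop0 lg').
exists (conj (g w / `|w| ^+ 2) *: w) => v.
rewrite innerZr (conj_involutive HK) -[v in inner v](subrK ((g v / g w) *: w)).
have gv : g (v - (g v / g w) *: w) = 0.
  by rewrite (linopB lg') (linopZ lg') /= -[_ *: _]/(_ * _) divfK// subrr.
rewrite innerDl innerZl inner_norm (innerC w) xo// (conj_nneg HK)// add0r.
by field; rewrite gw; move: w0; rewrite expf_eq0.
Qed.

Lemma adjoint_eq U V (f : U -> V) (g : V -> U) :
  (forall x y, inner (f x) y = inner x (g y)) -> adjoint f = g.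
Proof.
move=> H; apply/funext => y; rewrite /adjoint.
case: xgetP => [z _ Hz|/(_ (g y)) []//].
by apply: inner_extr => x; rewrite -Hz H.
Qed.

Lemma adjointP U V (f : U -> V) : bounded_operator f ->
  forall x y, inner (f x) y = inner x (adjoint f y).
Proof.
move=> /bounded_operatorP[C C0 [lf Hf]] x y; rewrite /adjoint.
case: xgetP => [z _ ->//|no].
have [|||z Hz] := @Riesz U (fun x => inner (f x) y) (C * (`|y| + 1)).
- by rewrite mulr_gt0 ?ltr_wpDl.
- by move=> a u v; rewrite lf innerDl innerZl.
- move=> u; apply: le_trans (inner_norm_le HK _ _) _; rewrite mulrAC.
  by apply: ler_pM => //; rewrite lerDl.
by have := no z.
Qed.

Lemma adjoint_bounded_by U V C (f : U -> V) : 0 <= C ->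
  bounded_by C f -> bounded_by C (adjoint f).
Proof.
move=> C0 bf; have fP := adjointP (bounded_by_operator bf); split=> [a x y|y].
  apply: inner_extr => z; rewrite -fP !innerDr !innerZr !fP//.
have [->|z0] := eqVneq (adjoint f y) 0; first by rewrite normr0 mulr_ge0.
rewrite -(ler_pM2r (_ : 0 < `|adjoint f y|)) ?normr_gt0// -expr2 -inner_norm -fP.
rewrite -[leLHS]ger0_norm; last by rewrite fP inner_norm exprn_ge0.
apply: le_trans (inner_norm_le HK _ _) _; rewrite mulrAC ler_wpM2r//.
by case: bf.
Qed.

Lemma adjoint_bounded U V (f : U -> V) : bounded_operator f -> bounded_operator (adjoint f).
Proof.
move=> /bounded_operatorP[C C0 bf].
exact: (bounded_by_operator (adjoint_bounded_by (ltW C0) bf)).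
Qed.

Definition selfadjoint U (P : U -> U) := forall x y, inner (P x) y = inner x (P y).

(** A selfadjoint operator with [<S x, x> >= a |x|^2], [a > 0], is bijective with
    an inverse bounded by [a^-1]. *)
Section Coercive.
Variables (U : hilbertType conj) (S : U -> U) (a : K).
Hypothesis (bS : bounded_operator S) (sS : selfadjoint S) (a0 : 0 < a).
Hypothesis aS : forall x, a * `|x| ^+ 2 <= inner (S x) x.

Lemma coercive_below x : a * `|x| <= `|S x|.
Proof.
have [->|x0] := eqVneq x 0; first by rewrite normr0 mulr0.
rewrite -(ler_pM2r (_ : 0 < `|x|)) ?normr_gt0// -mulrA -expr2.
apply: le_trans (aS x) _; rewrite -[leLHS]ger0_norm ?inner_norm_le//.
by apply: le_trans (aS x); rewrite mulr_ge0 ?exprn_ge0 ?(ltW a0).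
Qed.

Lemma coercive_inj : injective S.
Proof.
move=> x y Sxy; apply/eqP; rewrite -subr_eq0 -normr_le0 -(ler_pM2l a0) mulr0.
apply: le_trans (coercive_below _) _; case: bS => lS _.
by rewrite linopB// Sxy subrr normr0.
Qed.

(** The residue [w] of the projection of [y] on the range is orthogonal to [S w],
    so coercivity gives [w = 0] and the range is dense.  It is closed because [S]
    is bounded below. *)
Lemma coercive_surj y : exists x, S x = y.
Proof.
have [lS _] := bS.
have [||z [zM zo]] := projection HK (M := range S) y.
- by exists 0 => //; exact: linop0.
- by move=> b _ _ [u _ <-] [v _ <-]; exists (b *: u + v) => //; rewrite lS.
have yz : y = z.
  apply/eqP; rewrite -subr_eq0 -normr_le0.
  have := aS (y - z); rewrite sS zo; last exact: imageT.
  rewrite pmulr_rle0// => h.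
  by rewrite -(@ler_pXn2r _ 2)// ?nnegrE// expr0n.
subst z.
pose P e := [set m | `|y - S m| <= a * e].
have [||eta eta0|x Hx] := @nested_limit K U P.
- by move=> e e0; have [_ [m _ <-] Hm] := zM _ (mulr_gt0 a0 e0); exists m.
- by move=> e e' _ ee' m /= Hm; apply: le_trans Hm _; rewrite ler_pM2l.
- exists (eta / 2); first by rewrite divr_gt0.
  move=> u v Pu Pv; rewrite -(ler_pM2l a0); apply: le_trans (coercive_below _) _.
  rewrite (linopB lS).
  have -> : S u - S v = (y - S v) - (y - S u) by rewrite opprB [RHS]addrC addrA subrK.
  apply: le_trans (ler_normB _ _) _; rewrite [eta]splitr mulrDr.
  by apply: lerD.
exists x; have /bounded_operatorP[C C0 [_ HC]] := bS.
apply/eqP; rewrite -subr_eq0 -normr_le0; apply: (@ler_eps _ (C + a)).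
  by rewrite addr_ge0 ?ltW.
move=> e e0; have [e1 e10 He1] := Hx _ e0.
have [e2 [e20 e21 e2e]] := ltr_common e10 e0.
have [_ [m _ <-] Hm] := zM _ (mulr_gt0 a0 e20).
have -> : S x - y = S (x - m) - (y - S m) by rewrite linopB// opprB addrA subrK.
apply: le_trans (ler_normB _ _) _; rewrite add0r mulrDl; apply: lerD.
  apply: le_trans (HC _) _; rewrite ler_pM2l//; apply: He1.
  by rewrite /P /=; apply: le_trans Hm _; rewrite ler_pM2l.
by apply: le_trans Hm _; rewrite ler_pM2l.
Qed.

Lemma inverse_operatorK y : S (inverse_operator S y) = y.
Proof.
rewrite /inverse_operator; case: xgetP => [x _ //|no].
by have [x Hx] := coercive_surj y; have := no x.
Qed.

Lemma inverse_bounded_by : bounded_by a^-1 (inverse_operator S).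
Proof.
split=> [b x y|y].
  apply: coercive_inj; case: (bS) => lS _.
  by rewrite lS !inverse_operatorK.
by rewrite -ler_pdivrMl ?invr_gt0// invrK -{2}(inverse_operatorK y) coercive_below.
Qed.

Lemma inverse_selfadjoint : selfadjoint (inverse_operator S).
Proof.
by move=> x y; rewrite -{2}(inverse_operatorK x) sS inverse_operatorK.
Qed.

Lemma operatorK x : inverse_operator S (S x) = x.
Proof. by apply: coercive_inj; rewrite inverse_operatorK. Qed.
End Coercive.
End Ops.

Arguments inner_cvg {K conj} HK {U T F FF g l} y _.
Arguments inner_cvgr {K conj} HK {U T F FF g l} y _.

(** * Square roots of positive operators *)

Section SquareRoot.
Variables (K : numFieldType) (conj : K -> K).
Hypothesis HK : scalar_axioms conj.
Variable U : hilbertType conj.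
Implicit Types P D : U -> U.

Lemma selfadjoint_real P x : selfadjoint P -> inner (P x) x \is Num.real.
Proof.
move=> sP; have /esym e : conj (inner (P x) x) = inner (P x) x by rewrite -innerC sP.
have := add_conj_real HK (inner (P x) x); rewrite -e -mulr2n -mulr_natl => h.
by rewrite -(@mulKf _ (2 : K) _ (inner _ _))// rpredM// rpredV realn.
Qed.

(** This is positivity of [P] at the vector [x - M^-1 P x]; it stands in for the
    Cauchy-Schwarz inequality of the semi-inner product [<P x, y>]. *)
Lemma positive_sqr_norm_le P M x : 0 < M -> bounded_by M P -> positive_operator P ->
  `|P x| ^+ 2 <= M * inner (P x) x.
Proof.
move=> M0 [lP bP] [sP pP].
have := pP (x - M^-1 *: P x).
rewrite (linopB lP) (linopZ lP) innerBl !innerBr !innerZl !innerZr.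
rewrite (conj_nneg HK) ?invr_ge0 ?(ltW M0)// (sP (P x) x) !inner_norm.
set q := inner (P x) x; set n2 := `|P x| ^+ 2; set r := inner (P (P x)) (P x) => H.
have rM : r <= M * n2.
  rewrite -[leLHS]ger0_norm ?pP//; apply: le_trans (inner_norm_le HK _ _) _.
  by rewrite /n2 expr2 mulrA ler_wpM2r.
rewrite -(ler_pM2l (_ : 0 < M^-1)) ?invr_gt0// mulKf ?gt_eqF// -subr_ge0.
apply: le_trans H _.
rewrite -subr_ge0.
have -> : q - M^-1 * n2 - (q - M^-1 * n2 - (M^-1 * n2 - M^-1 * (M^-1 * r))) =
   M^-1 * (M^-1 * (M * n2 - r)) by field; rewrite gt_eqF.
by rewrite !mulr_ge0 ?invr_ge0 ?(ltW M0) ?subr_ge0.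
Qed.

(** For a selfadjoint contraction [D], the operators [Y_0 = 0],
    [Y_(n+1) = (D + Y_n^2) / 2] converge to a solution of [2 Z = D + Z^2], that
    is, of [(1 - Z)^2 = 1 - D].  The scalar sequence [sqrt_bound], the case
    [D = 1], bounds both [Y_n] and, through its increments, [Y_(n+1) - Y_n]. *)
Section Iteration.
Variable D : U -> U.
Hypotheses (bD : bounded_by 1 D) (sD : selfadjoint D).

Fixpoint sqrt_iter (n : nat) : U -> U :=
  if n is m.+1 then fun x => 2^-1 *: (D x + sqrt_iter m (sqrt_iter m x)) else fun=> 0.

Fixpoint sqrt_bound (n : nat) : K :=
  if n is m.+1 then (1 + sqrt_bound m ^+ 2) / 2 else 0.

Local Notation Y := sqrt_iter.
Local Notation a := sqrt_bound.

Lemma sqrt_bound_itv n : 0 <= a n <= 1.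
Proof.
elim: n => [|n /andP[h0 h1]] /=; first by rewrite lexx ler01.
rewrite divr_ge0 ?addr_ge0 ?exprn_ge0//= ler_pdivrMr// mul1r.
by rewrite [leRHS](_ : 2 = 1 + 1)// lerD2l exprn_ile1.
Qed.

Lemma sqrt_bound_ge0 n : 0 <= a n.
Proof. by have /andP[] := sqrt_bound_itv n. Qed.

Lemma sqrt_bound_step n : a n <= a n.+1.
Proof.
elim: n => [|n IH]; first exact: sqrt_bound_ge0.
rewrite [a n.+2]/= [X in X <= _]/= ler_pM2r ?invr_gt0// lerD2l.
by apply: lerXn2r IH; [exact: (sqrt_bound_ge0 n)|exact: (sqrt_bound_ge0 n.+1)].
Qed.

Lemma sqrt_iter_bounded n : bounded_by (a n) (Y n).
Proof.
case: bD => lD nD; elim: n => [|n [ln nn]].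
  by split=> [b x y|x] /=; rewrite ?scaler0 ?addr0 ?normr0 ?mul0r.
split=> [b x y|x].
  by rewrite /= !ln lD addrACA -[X in _ *: (X + _)]scalerDr [LHS]scalerDr !scalerA (mulrC b).
rewrite [Y _ _]/= normrZ ger0_norm ?invr_ge0// [a _]/= mulrAC mulrC ler_wpM2r ?invr_ge0//.
rewrite mulrDl; apply: le_trans (ler_normD _ _) _; apply: lerD; first exact: nD.
apply: le_trans (nn _) _; rewrite expr2 -mulrA ler_wpM2l//.
exact: sqrt_bound_ge0.
Qed.

Lemma sqrt_iter_selfadjoint n : selfadjoint (Y n).
Proof.
elim: n => [|n IH] x y /=; first by rewrite inner0l inner0r.
rewrite innerZl innerZr (conj_nneg HK) ?invr_ge0// innerDl innerDr sD.
by rewrite !IH.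
Qed.

(** [Y^2 - Y'^2 = Y (Y - Y') + (Y - Y') Y'], both for the operators and for the
    scalars of [sqrt_bound]. *)
Lemma sqrt_iter_step n x : `|Y n.+1 x - Y n x| <= (a n.+1 - a n) * `|x|.
Proof.
elim: n x => [|n IH] x.
  rewrite !subr0; have [_ h] := sqrt_iter_bounded 1; exact: h.
have [l1 n1] := sqrt_iter_bounded n.+1; have [l0 n0] := sqrt_iter_bounded n.
have -> : Y n.+2 x - Y n.+1 x =
    2^-1 *: (Y n.+1 (Y n.+1 x - Y n x) + (Y n.+1 (Y n x) - Y n (Y n x))).
  rewrite (linopB l1) addrA subrK [Y n.+2 x]/=.
  rewrite [X in _ - X]/= -scalerBr; congr (_ *: _).
  by rewrite opprD addrACA subrr add0r.
have -> : a n.+2 - a n.+1 = 2^-1 * (a n.+1 * (a n.+1 - a n) + (a n.+1 - a n) * a n).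
  have -> : a n.+2 = (1 + a n.+1 ^+ 2) / 2 by [].
  by rewrite [in X in _ - X = _](_ : a n.+1 = (1 + a n ^+ 2) / 2)//; field.
rewrite normrZ ger0_norm ?invr_ge0// -mulrA ler_wpM2l ?invr_ge0//.
apply: le_trans (ler_normD _ _) _; rewrite mulrDl; apply: lerD.
  apply: le_trans (n1 _) _; rewrite -mulrA ler_wpM2l//; exact: sqrt_bound_ge0.
apply: le_trans (IH _) _; rewrite -mulrA ler_wpM2l//.
by rewrite subr_ge0 sqrt_bound_step.
Qed.

Lemma sqrt_bound_mono m n : (m <= n)%N -> a m <= a n.
Proof.
move=> /subnKC <-; elim: (n - m)%N => [|k IH]; first by rewrite addn0.
by rewrite addnS; apply: le_trans IH (sqrt_bound_step _).
Qed.

Lemma sqrt_iter_dist m n x : (m <= n)%N -> `|Y n x - Y m x| <= (a n - a m) * `|x|.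
Proof.
move=> /subnKC <-; elim: (n - m)%N => [|k IH].
  by rewrite addn0 !subrr normr0 mul0r.
rewrite addnS -(subrK (Y (m + k) x) (Y _ x)) -addrA; apply: le_trans (ler_normD _ _) _.
rewrite -(subrK (a (m + k)) (a _.+1)) -addrA mulrDl; apply: lerD => //.
exact: sqrt_iter_step.
Qed.

Definition sqrt_lim x : U := lim (Y n x @[n --> \oo]).
Local Notation Z := sqrt_lim.

(** The sequence [1 - sqrt_bound n] is nonincreasing and nonnegative.  Once it is
    within [eps] of its infimum, all later increments of [sqrt_bound], and with
    them those of the operators, are at most [eps]. *)
Lemma sqrt_iter_cvg x : Y n x @[n --> \oo] --> Z x.
Proof.
have [||d dle dinf] := nonneg_inf HK (S := range (fun n => 1 - a n)).
- by exists (1 - a 0), 0%N.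
- by move=> _ [n _ <-] /=; rewrite subr_ge0; case/andP: (sqrt_bound_itv n).
apply: cauchy_cvg; apply: cauchy_exP => eps eps0.
have x1 : 0 < `|x| + 1 by rewrite ltr_wpDl.
have [|_ [N _ <-] HN] := dinf (eps / (`|x| + 1)); first by rewrite divr_gt0.
exists (Y N x); exists N => // n /= Nn.
rewrite -ball_normE /= distrC; apply: le_lt_trans (sqrt_iter_dist x Nn) _.
apply: (@le_lt_trans _ _ ((a n - a N) * (`|x| + 1))).
  by rewrite ler_wpM2l ?lerDl// subr_ge0 sqrt_bound_mono.
rewrite -ltr_pdivlMr// -(ltrD2l d); apply: le_lt_trans HN.
by rewrite addrA lerD2r -lerBrDr; apply: dle; exists n.
Qed.

Arguments sqrt_iter_cvg : clear implicits.

Lemma sqrt_lim_bounded : bounded_by 1 Z.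
Proof.
split=> [b x y|x].
  apply: (@lim_ext K U _ \oo _ _ _ _ _ (sqrt_iter_cvg _)
    (cvgD (cvgZr (k := b) (sqrt_iter_cvg x)) (sqrt_iter_cvg y))).
  by move=> n; have [-> _] := sqrt_iter_bounded n.
apply: (@cvg_norm_le K U _ _ _ _ _ _ (sqrt_iter_cvg x)); apply: nearW => n.
have [_ h] := sqrt_iter_bounded n; apply: le_trans (h x) _.
by rewrite ler_wpM2r//; case/andP: (sqrt_bound_itv n).
Qed.

Lemma sqrt_lim_selfadjoint : selfadjoint Z.
Proof.
move=> x y; apply: (@lim_ext K K^o nat \oo _ _ _ _ _ (inner_cvg HK y (sqrt_iter_cvg x))
  (inner_cvgr HK x (sqrt_iter_cvg y))) => n.
exact: sqrt_iter_selfadjoint.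
Qed.

Lemma sqrt_lim_eq x : 2 *: Z x = D x + Z (Z x).
Proof.
have YY : Y n (Y n x) @[n --> \oo] --> Z (Z x).
  have -> : (fun n => Y n (Y n x)) =
    (fun n => Y n (Y n x - Z x)) \+ (fun n => Y n (Z x)).
    by apply/funext => n /=; have [l _] := sqrt_iter_bounded n; rewrite (linopB l) subrK.
  rewrite -[Z (Z x)]add0r; apply: cvgD; last exact: sqrt_iter_cvg.
  have /cvgrPdist_le h := sqrt_iter_cvg x; apply/cvgrPdist_le => e e0.
  near=> n; have [_ b] := sqrt_iter_bounded n.
  rewrite sub0r normrN; apply: le_trans (b _) _.
  apply: (@le_trans _ _ (1 * `|Y n x - Z x|)).
    by rewrite ler_wpM2r//; case/andP: (sqrt_bound_itv n).
  by rewrite mul1r distrC; near: n; exact: h.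
have Y1 : Y n.+1 x @[n --> \oo] --> Z x.
  by rewrite (cvg_shiftS (fun n => Y n x)); exact: sqrt_iter_cvg.
apply: (@lim_ext K U _ \oo _ _ _ _ _ (cvgZr (k := 2) Y1) (cvgD (cvg_cst (D x)) YY)) => n /=.
by rewrite scalerA divff ?pnatr_eq0// scale1r.
Unshelve. all: by end_near. Qed.
End Iteration.

(** After scaling to [P = s^2 (1 - D)] with [D] a selfadjoint contraction, a
    square root is [s (1 - Z)] for the limit [Z] of the iteration. *)
Lemma positive_sqrt P : bounded_operator P -> positive_operator P ->
  exists Q, [/\ bounded_operator Q, positive_operator Q & Q \o Q = P].
Proof.
move=> /bounded_operatorP[C C0 [lP nP]] [sP pP].
(* The scaling factor M is a perfect square above the bound C of P, so no scalar
   square root is needed. *)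
pose s := C + 1; pose M := s ^+ 2; have s0 : 0 < s by rewrite addr_gt0.
have M0 : 0 < M by rewrite exprn_gt0.
have bP : bounded_by M P.
  split=> // x; apply: le_trans (nP x) _; rewrite ler_wpM2r//.
  apply: (@le_trans _ _ s); first by rewrite lerDl.
  by rewrite /M expr2 ler_peMl ?(ltW s0)// lerDr ltW.
pose D x := x - M^-1 *: P x.
have bD : bounded_by 1 D.
  split=> [b x y|x].
    by rewrite /D lP scalerBr scalerDr !scalerA (mulrC M^-1) opprD addrACA.
  rewrite mul1r; apply: ler_of_sqr => //; rewrite sqr_normB normrZ.
  rewrite exprMn innerZr (conj_nneg HK) ?invr_ge0 ?(ltW M0)// -sP (conj_nneg HK); last first.
    by rewrite mulr_ge0 ?invr_ge0 ?(ltW M0).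
  rewrite -addrA gerDl subr_le0 ger0_norm ?invr_ge0 ?(ltW M0)//.
  apply: (@le_trans _ _ (M^-1 * inner (P x) x)); last first.
    by rewrite lerDl mulr_ge0 ?invr_ge0 ?(ltW M0).
  rewrite expr2 -mulrA ler_wpM2l ?invr_ge0 ?(ltW M0)// ler_pdivrMl//.
  exact: positive_sqr_norm_le.
have sD : selfadjoint D.
  move=> x y; rewrite /D innerBl innerBr innerZl innerZr sP.
  by rewrite (conj_nneg HK) ?invr_ge0 ?(ltW M0).
have [lZ nZ] := sqrt_lim_bounded bD; have sZ := sqrt_lim_selfadjoint bD sD.
have Zeq := sqrt_lim_eq bD; set Z := sqrt_lim D in lZ nZ sZ Zeq.
exists (fun x => s *: (x - Z x)); split.
- split=> [b x y|].
    by rewrite lZ opprD addrACA -scalerBr scalerDr !scalerA mulrC.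
  exists (s * 2) => x; rewrite normrZ (gtr0_norm s0) -mulrA ler_pM2l//.
  apply: le_trans (ler_normB _ _) _; rewrite mulrDl mul1r lerD2l.
  by apply: le_trans (nZ x) _; rewrite mul1r.
- split=> [x y|x].
    by rewrite innerZl innerZr innerBl innerBr sZ (conj_nneg HK)// ltW.
  (* <Z x, x> is real and its absolute value is at most |x|^2. *)
  rewrite innerZl mulr_ge0 ?(ltW s0)// innerBl subr_ge0 inner_norm.
  apply: le_trans (real_ler_norm (selfadjoint_real _ sZ)) _.
  apply: le_trans (inner_norm_le HK _ _) _; rewrite expr2 ler_wpM2r//.
  by apply: le_trans (nZ x) _; rewrite mul1r.
- apply/funext => x /=.
  rewrite (linopZ lZ) -scalerBr scalerA -expr2 (linopB lZ).
  have -> : x - Z x - (Z x - Z (Z x)) = M^-1 *: P x.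
    have -> : Z (Z x) = 2 *: Z x - D x by rewrite Zeq addrAC subrr add0r.
    have e (z d : U) : z - (z + z - d) = d - z.
      by rewrite -addrA opprD addrA subrr sub0r opprB.
    by rewrite scaler_nat mulr2n e opprB subrKA /D opprB addrC subrK.
  by rewrite scalerA divff ?scale1r// gt_eqF.
Qed.
End SquareRoot.

(** * Orthonormal bases and the Hilbert-Schmidt norm *)

Lemma sum_subset_split (M : nmodType) (I : eqType) (s1 s2 : seq I) (f : I -> M) :
  uniq s1 -> uniq s2 -> {subset s1 <= s2} ->
  \sum_(i <- s2) f i = \sum_(i <- s1) f i + \sum_(i <- s2 | i \notin s1) f i.
Proof.
move=> u1 u2 s12; rewrite (bigID (mem s1)) /=; congr (_ + _).
rewrite -big_filter; apply: perm_big; apply: uniq_perm; rewrite ?filter_uniq// => x.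
by rewrite mem_filter; apply: andb_idr; exact: s12.
Qed.

Lemma ler_sum_subset (K : numDomainType) (I : eqType) (s1 s2 : seq I) (f : I -> K) :
  uniq s1 -> uniq s2 -> {subset s1 <= s2} -> (forall i, 0 <= f i) ->
  \sum_(i <- s1) f i <= \sum_(i <- s2) f i.
Proof.
by move=> u1 u2 s12 f0; rewrite (sum_subset_split f u1 u2 s12) lerDl sumr_ge0.
Qed.

Section Bases.
Variables (K : numFieldType) (conj : K -> K).
Hypothesis HK : scalar_axioms conj.
Variables (U : hilbertType conj) (E : set U).
Implicit Types (s G : seq U) (x y : U).

Lemma sqr_normD_ortho x y : inner x y = 0 -> `|x + y| ^+ 2 = `|x| ^+ 2 + `|y| ^+ 2.
Proof. by move=> xy; rewrite sqr_normD xy (conj_nneg HK)// !addr0. Qed.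

Section Orthonormal.
Hypothesis oE : orthonormal_set E.

Lemma orthonormal_norm e : E e -> `|e| = 1.
Proof.
move=> Ee; apply/eqP; rewrite -(@eqrXn2 _ 2)// expr1n -inner_norm oE// eqxx.
by [].
Qed.

Lemma inner_orthonormal_sum s (c : U -> K) e : uniq s -> (forall e, e \in s -> E e) ->
  e \in s -> inner (\sum_(e' <- s) c e' *: e') e = c e.
Proof.
move=> us sE es; rewrite inner_suml (bigD1_seq e)//= innerZl oE ?eqxx ?mulr1; try exact: sE.
rewrite big1_seq ?addr0// => e' /andP[ne' e's].
by rewrite innerZl oE ?(negPf ne') ?mulr0//; exact: sE.
Qed.

Lemma sqr_norm_orthonormal_sum s (c : U -> K) : uniq s -> (forall e, e \in s -> E e) ->
  `|\sum_(e <- s) c e *: e| ^+ 2 = \sum_(e <- s) `|c e| ^+ 2.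
Proof.
elim: s => [|e s IH] /=; first by rewrite !big_nil normr0 expr0n.
move=> /andP[es us] sE; rewrite !big_cons sqr_normD_ortho.
  rewrite IH//; last by move=> e' e's; apply: sE; rewrite inE e's orbT.
  by rewrite normrZ (orthonormal_norm (sE e _)) ?mulr1// mem_head.
rewrite innerZl inner_sumr big1_seq ?mulr0// => e' /= e's.
rewrite innerZr oE; [|by apply: sE; rewrite mem_head|by apply: sE; rewrite inE e's orbT].
by case: eqVneq es => [->|_ _]; rewrite ?e's// mulr0.
Qed.

Lemma ortho_residue s x e : uniq s -> (forall e, e \in s -> E e) -> e \in s ->
  inner (x - \sum_(e <- s) inner x e *: e) e = 0.
Proof. by move=> us sE es; rewrite innerBl inner_orthonormal_sum// subrr. Qed.

Lemma sqr_norm_residue s x : uniq s -> (forall e, e \in s -> E e) ->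
  `|x| ^+ 2 = `|x - \sum_(e <- s) inner x e *: e| ^+ 2 + \sum_(e <- s) `|inner x e| ^+ 2.
Proof.
move=> us sE; rewrite -sqr_norm_orthonormal_sum// -sqr_normD_ortho ?subrK//.
rewrite inner_sumr big1_seq// => e /= es.
by rewrite innerZr ortho_residue ?mulr0.
Qed.

Lemma Bessel s x : uniq s -> (forall e, e \in s -> E e) ->
  \sum_(e <- s) `|inner x e| ^+ 2 <= `|x| ^+ 2.
Proof. by move=> us sE; rewrite (sqr_norm_residue x us sE) lerDr exprn_ge0. Qed.
End Orthonormal.

Hypothesis bE : orthonormal_basis E.

(** Otherwise the normalized vector could be added to the maximal orthonormal
    set. *)
Lemma basis_ortho_eq0 w : (forall e, E e -> inner w e = 0) -> w = 0.
Proof.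
move=> wE; apply/eqP/negPn/negP => w0; have [oE maxE] := bE.
have n0 : 0 < `|w| by rewrite normr_gt0.
pose u := `|w|^-1 *: w.
have uE e : E e -> inner u e = 0 by move=> Ee; rewrite innerZl wE ?mulr0.
have uu : inner u u = 1.
  by rewrite inner_norm normrZ ger0_norm ?invr_ge0// mulVf ?expr1n// gt_eqF.
have neu e : E e -> (u == e) = false.
  move=> Ee; apply/eqP => ue; have := uE _ Ee; rewrite -ue uu; apply/eqP.
  exact: oner_neq0.
have : (E `|` [set u]) = E.
  apply: maxE; last by move=> e; left.
  move=> x y [Ex|->] [Ey|->]; first exact: oE.
  - by rewrite innerC uE// eq_sym neu// (conj_nneg HK).
  - by rewrite uE// neu.
  - by rewrite uu eqxx.
move=> EU; have Eu : E u by rewrite -EU; right.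
by have := neu _ Eu; rewrite eqxx.
Qed.

(** Finite combinations of basis vectors are dense by [projection] and
    [basis_ortho_eq0], and among the combinations of given basis vectors the
    Fourier sum is the closest to [x]. *)
Lemma Parseval_approx x eta : 0 < eta -> exists2 s,
  uniq s /\ (forall e, e \in s -> E e) &
  `|x| ^+ 2 <= \sum_(e <- s) `|inner x e| ^+ 2 + eta.
Proof.
move=> eta0; have [oE _] := bE.
pose M m := exists2 l : seq (K * U), (forall p, p \in l -> E p.2) &
   m = \sum_(p <- l) p.1 *: p.2.
have [||z [zM zo]] := projection HK (M := M) x.
- by exists [::]; rewrite ?big_nil.
- move=> a _ _ [l1 l1E ->] [l2 l2E ->].
  exists ([seq (a * p.1, p.2) | p <- l1] ++ l2).
    by move=> p; rewrite mem_cat => /orP[/mapP[q /l1E qE ->]|/l2E].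
  rewrite big_cat big_map scaler_sumr; congr (_ + _).
  by apply: eq_bigr => p _; rewrite scalerA.
have xz : x - z = 0.
  apply: basis_ortho_eq0 => e Ee; apply: zo; exists [:: (1, e)].
    by move=> p; rewrite inE => /eqP->.
  by rewrite big_seq1 scale1r.
have [h [h0 h1 heta]] := ltr_common ltr01 eta0.
have [_ [l lE ->]] := zM _ h0.
have -> : z = x by apply/eqP; rewrite eq_sym -subr_eq0 xz.
set m := \sum_(p <- l) _ => xm.
pose s := undup [seq p.2 | p <- l].
have us : uniq s by exact: undup_uniq.
have sE e : e \in s -> E e by rewrite mem_undup => /mapP[p pl ->]; exact: lE.
exists s => //; rewrite addrC (sqr_norm_residue oE x us sE) lerD2r.
set r := x - _.
have rs e : e \in s -> inner r e = 0 by exact: ortho_residue.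
have -> : `|r| ^+ 2 = `|x - m| ^+ 2 - `|(\sum_(e <- s) inner x e *: e) - m| ^+ 2.
  have -> : x - m = r + (\sum_(e <- s) inner x e *: e - m) by rewrite /r subrKA.
  rewrite sqr_normD_ortho ?addrK//.
  rewrite innerBr inner_sumr big1_seq ?sub0r; last first.
    by move=> e /= es; rewrite innerZr rs// mulr0.
  rewrite inner_sumr big1_seq ?oppr0// => p /= pl.
  by rewrite innerZr rs ?mulr0// mem_undup map_f.
rewrite lerBlDr; apply: (@le_trans _ _ (h ^+ 2)).
  by apply: lerXn2r; rewrite ?nnegrE ?(ltW h0).
apply: (@le_trans _ _ eta); last by rewrite lerDl exprn_ge0.
by apply: le_trans heta; rewrite expr2 ler_piMl ?(ltW h0).
Qed.

(** The sums of [|Y^* e|^2] and of [|Y e'|^2] over the basis are both the double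
    sum of [|<Y e', e>|^2].  Parseval is needed for [Y^* e], up to a small error
    over a finite part [G] of the basis, and only Bessel for [Y e']. *)
Lemma sum_sqr_adjoint_le (Y : U -> U) (beta : K) s : bounded_operator Y ->
  (forall G, uniq G -> (forall e, e \in G -> E e) -> \sum_(e <- G) `|Y e| ^+ 2 <= beta) ->
  uniq s -> (forall e, e \in s -> E e) ->
  \sum_(e <- s) `|adjoint Y e| ^+ 2 <= beta.
Proof.
move=> bY Hb us sE; have [oE _] := bE.
apply: (@ler_eps _ (size s)%:R); rewrite ?ler0n// => eta eta0.
have /choice[g Hg] : forall e, exists G, [/\ uniq G, forall e, e \in G -> E e &
  `|adjoint Y e| ^+ 2 <= \sum_(e' <- G) `|inner (adjoint Y e) e'| ^+ 2 + eta].
  by move=> e; have [G [uG GE] H] := Parseval_approx (adjoint Y e) eta0; exists G.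
pose G := undup (flatten [seq g e | e <- s]).
have uG : uniq G by exact: undup_uniq.
have GE e : e \in G -> E e.
  by rewrite mem_undup => /flatten_mapP[e' _]; case: (Hg e') => _ h _; exact: h.
apply: (@le_trans _ _ (\sum_(e <- s) (\sum_(e' <- G) `|inner (adjoint Y e) e'| ^+ 2 + eta))).
  rewrite big_seq [leRHS]big_seq; apply: ler_sum => e es.
  have [ug gE H] := Hg e; apply: le_trans H _; rewrite lerD2r.
  apply: ler_sum_subset => // e' e'g.
  by rewrite mem_undup; apply/flatten_mapP; exists e.
rewrite big_split /= big_const_seq count_predT iter_addr_0 mulr_natl lerD2r.
rewrite exchange_big /=; apply: le_trans (Hb G uG GE).
apply: ler_sum => e' _; apply: le_trans (Bessel oE (Y e') us sE).
apply: ler_sum => e _; rewrite innerC -(adjointP HK bY) conj_norm//.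
Qed.
End Bases.

(** * Traces of trace class operators *)

Section Trace.
Variables (K : numFieldType) (conj : K -> K).
Hypothesis HK : scalar_axioms conj.
Variable U : hilbertType conj.
Implicit Types (A X P : U -> U) (E : set U).

Lemma adjointPr (V W : hilbertType conj) (f : V -> W) : bounded_operator f ->
  forall x y, inner (adjoint f y) x = inner y (f x).
Proof. by move=> bf x y; rewrite innerC -(adjointP HK bf) -innerC. Qed.

(** Existence of a positive square root of [A^* A] makes the choice operator in
    [absolute_value] meaningful. *)
Lemma absolute_valueP A : bounded_operator A ->
  [/\ bounded_operator (absolute_value A), positive_operator (absolute_value A) &
      absolute_value A \o absolute_value A = adjoint A \o A].
Proof.
move=> bA; rewrite /absolute_value; case: xgetP => [P _ //|no].
have bAA := bounded_comp (adjoint_bounded HK bA) bA.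
have [|Q HQ] := positive_sqrt HK bAA; last by have := no Q.
split=> [x y|x] /=; first by rewrite adjointPr// -adjointP.
by rewrite adjointPr// inner_norm exprn_ge0.
Qed.

Lemma absolute_value_norm A x : bounded_operator A -> `|absolute_value A x| = `|A x|.
Proof.
move=> bA; have [_ [sP _] PP] := absolute_valueP bA.
apply/eqP; rewrite -(@eqrXn2 _ 2)// -!inner_norm.
by rewrite -sP -[absolute_value A _]/((_ \o _) x) PP /= adjointPr.
Qed.

(** With [Q^2 = P] and the contraction [W = A (P + eps)^-1], the term
    [<X A e, e>] is [<Q e, (X W Q)^* e>] plus an error of size [eps C]; the
    inequality of [young_le] with weight [t] separates the two factors, and the
    second is summed by [sum_sqr_adjoint_le]. *)
Lemma sum_inner_le E A X (C tau t : K) (s : seq U) :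
  orthonormal_basis E -> bounded_operator A ->
  (forall G, uniq G -> (forall e, e \in G -> E e) ->
     \sum_(e <- G) inner (absolute_value A e) e <= tau) ->
  0 <= C -> bounded_by C X -> uniq s -> (forall e, e \in s -> E e) -> 0 < t ->
  2 * `|\sum_(e <- s) inner (X (A e)) e| <=
    t * \sum_(e <- s) inner (absolute_value A e) e + t^-1 * (C ^+ 2 * tau).
Proof.
move=> bE bA Htau C0 bX us sE t0; have [oE _] := bE.
have [bP pP _] := absolute_valueP bA; have nPA x := absolute_value_norm x bA.
set P := absolute_value A in Htau bP pP nPA *.
have [sP P0] := pP; have [lP _] := bP; have [lA _] := bA.
have [Q [bQ [sQ _] QQ]] := positive_sqrt HK bP pP.
have QP e : `|Q e| ^+ 2 = inner (P e) e by rewrite -QQ /= sQ inner_norm.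
apply: (@ler_eps _ (2 * (C * (size s)%:R))); rewrite ?mulr_ge0 ?ler0n// => eps eps0.
pose S x := P x + eps *: x.
have bS : bounded_operator S.
  have [_ [M HM]] := bP; split=> [b x y|].
    by rewrite /S lP scalerDr !scalerDr !scalerA (mulrC eps) addrACA.
  exists (M + eps) => x; apply: le_trans (ler_normD _ _) _.
  by rewrite normrZ gtr0_norm// mulrDl lerD2r.
have sS : selfadjoint S.
  by move=> x y; rewrite innerDl innerDr sP innerZl innerZr (conj_nneg HK)// ltW.
have cS x : eps * `|x| ^+ 2 <= inner (S x) x.
  by rewrite /S innerDl innerZl inner_norm lerDr.
pose R := inverse_operator S.
have SR x : S (R x) = x by exact: inverse_operatorK cS _.
have RS x : R (S x) = x by exact: operatorK cS _.
have [lR _] : bounded_by eps^-1 R by exact: inverse_bounded_by cS.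
pose W := A \o R.
have bW : bounded_by 1 W.
  split=> [b x y|x]; first by rewrite /W /= lR lA.
  (* |P y| <= |(P + eps) y| since <P y, y> >= 0. *)
  rewrite mul1r /W /= -nPA -{2}(SR x); move: (R x) => y.
  apply: ler_of_sqr => //; rewrite /S sqr_normD -addrA lerDl.
  have q0 : 0 <= inner (P y) (eps *: y).
    by rewrite innerZr (conj_nneg HK) ?mulr_ge0 ?(ltW eps0).
  by rewrite (conj_nneg HK)// !addr_ge0// exprn_ge0.
have bZ : bounded_by (C * 1) (X \o W) by exact: bounded_by_comp.
rewrite mulr1 in bZ; set Z := X \o W in bZ; have [lZ nZ] := bZ.
have bZ' := bounded_by_operator bZ.
have bZQ := bounded_comp bZ' bQ.
have XA e : inner (X (A e)) e = inner (Q e) (adjoint (Z \o Q) e) + eps * inner (Z e) e.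
  have -> : X (A e) = Z (S e) by rewrite /Z /W /= RS.
  rewrite /S (linopD lZ) (linopZ lZ) innerDl innerZl; congr (_ + _).
  by rewrite -QQ /= -(adjointP HK bZQ).
under eq_bigr do rewrite XA.
rewrite big_split /= -mulr_sumr; apply: le_trans (ler_wpM2l _ (ler_normD _ _)) _ => //.
rewrite mulrDr; apply: lerD; last first.
  rewrite normrM (gtr0_norm eps0) -(mulrA 2) ler_pM2l// mulrC ler_wpM2r ?(ltW eps0)//.
  apply: le_trans (ler_norm_sum _ _ _) _.
  apply: (@le_trans _ _ (\sum_(e <- s) C)); last first.
    by rewrite big_const_seq count_predT iter_addr_0 mulr_natr.
  rewrite big_seq [leRHS]big_seq; apply: ler_sum => e es.
  apply: le_trans (inner_norm_le HK _ _) _; rewrite (orthonormal_norm oE (sE _ es)) mulr1.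
  by apply: le_trans (nZ e) _; rewrite (orthonormal_norm oE (sE _ es)) mulr1.
apply: (@le_trans _ _ (\sum_(e <- s) (t * `|Q e| ^+ 2 + t^-1 * `|adjoint (Z \o Q) e| ^+ 2))).
  apply: (@le_trans _ _ (2 * \sum_(e <- s) `|inner (Q e) (adjoint (Z \o Q) e)|)).
    by rewrite ler_wpM2l// ler_norm_sum.
  rewrite mulr_sumr; apply: ler_sum => e _.
  apply: (@le_trans _ _ (2 * (`|Q e| * `|adjoint (Z \o Q) e|))); last exact: young_le.
  by rewrite ler_wpM2l// (inner_norm_le HK).
rewrite big_split /= -!mulr_sumr; apply: lerD.
  by rewrite ler_wpM2l ?(ltW t0)//; apply: ler_sum => e _; rewrite QP.
rewrite ler_wpM2l ?invr_ge0 ?(ltW t0)//.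
apply: (sum_sqr_adjoint_le HK bE bZQ) => // G uG GE.
apply: (@le_trans _ _ (C ^+ 2 * \sum_(e <- G) `|Q e| ^+ 2)).
  rewrite mulr_sumr; apply: ler_sum => e _; rewrite -exprMn.
  by apply: lerXn2r; rewrite ?nnegrE ?mulr_ge0//; exact: nZ.
rewrite ler_wpM2l ?exprn_ge0//; under eq_bigr do rewrite QP.
exact: Htau.
Qed.

Lemma diagonal_sumsE E A (F : {fset U}) :
  diagonal_sums E A F = \sum_(e <- [seq e <- F | e \in E]) inner (A e) e.
Proof.
rewrite /diagonal_sums /summability.partial_sum.
rewrite -(big_seq_fsetE _ F xpredT (patch (fun=> 0) E (fun e => inner (A e) e : K^o))).
rewrite big_filter [RHS]big_mkcond /=.
by apply: eq_bigr => e _; rewrite patchE.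
Qed.
End Trace.

#[local] Existing Instance summability.totally_filter.

Section WeakStar.
Variables (K : numFieldType) (conj : K -> K).
Hypothesis HK : scalar_axioms conj.
Variable U : hilbertType conj.
Implicit Types (A X P : U -> U) (E : set U).

Local Notation totally := summability.totally.

Lemma diagonal_sums_split E A (F0 F : {fset U}) : (F0 `<=` F)%fset ->
  exists2 s : seq U, uniq s /\ (forall e, e \in s -> E e) & forall A,
    diagonal_sums E A F = diagonal_sums E A F0 + \sum_(e <- s) inner (A e) e.
Proof.
move=> F0F; exists [seq e <- [seq e <- F | e \in E] | e \notin [seq e <- F0 | e \in E]].
  split; first by rewrite !filter_uniq// fset_uniq.
  by move=> e; rewrite !mem_filter => /andP[_ /andP[/set_mem]].
move=> B; rewrite !diagonal_sumsE [X in _ + X]big_filter.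
apply: sum_subset_split; rewrite ?filter_uniq ?fset_uniq// => e.
by rewrite !mem_filter => /andP[-> /(fsubsetP F0F)].
Qed.

(** Completeness of the scalars along an arbitrary filter, inherited from [U]
    through the isometric line spanned by a unit vector [e]. *)
Lemma scalar_cvg (e : U) (T : Type) (F : set_system T) {FF : ProperFilter F}
    (f : T -> K) : `|e| = 1 ->
  (forall eps, 0 < eps -> exists z, \forall t \near F, `|z - f t| <= eps) ->
  cvg ((f : T -> K^o) @ F).
Proof.
move=> e1 Cf; pose g t := f t *: e.
have /cvg_ex[l gl] : cvg (g @ F).
  apply: cauchy_cvg; apply: cauchy_exP => eps eps0.
  have [|z Hz] := Cf (eps / 2); first by rewrite divr_gt0.
  exists (z *: e); rewrite /= nbhs_simpl; apply: filterS Hz => t Ht.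
  rewrite -ball_normE /= /g -scalerBl normrZ e1 mulr1; apply: le_lt_trans Ht _.
  by rewrite ltr_pdivrMr// ltr_pMr// ltr1n.
apply/cvg_ex; exists (inner l e).
have -> : f = (fun t => inner (g t) e).
  by apply/funext => t; rewrite /g innerZl inner_norm e1 expr1n mulr1.
exact: (inner_cvg HK).
Qed.

Section TraceClass.
Variables (E : set U) (A : U -> U).
Hypotheses (bE : orthonormal_basis E) (tA : trace_class E A).

(** [F0] is chosen independently of [X].  In [sum_inner_le] the weight [t] is
    taken large enough to make the second term at most [eta], and then [F0] large
    enough to make the tail of the trace of [P], multiplied by [t], at most
    [eta]. *)
Lemma uniform_tails (C eta : K) : 0 < C -> 0 < eta ->
  exists F0 : {fset U}, forall X, bounded_by C X -> forall F : {fset U},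
    (F0 `<=` F)%fset ->
    `|diagonal_sums E (X \o A) F - diagonal_sums E (X \o A) F0| <= eta.
Proof.
move=> C0 eta0; have [bA /cvg_ex[tau /cvgrPdist_le Htau]] := tA.
have [bP pP _] := absolute_valueP HK bA.
set P := absolute_value A in Htau bP pP *.
have [sP P0] := pP.
have tauP s : uniq s -> (forall e, e \in s -> E e) ->
    \sum_(e <- s) inner (P e) e <= `|tau|.
  move=> us sE; apply/ler_addgt0Pr => e e0; have [F0 _ HF0] := Htau e e0.
  pose F := (F0 `|` [fset e in s])%fset.
  have /HF0 : (F0 `<=` F)%fset by exact: fsubsetUl.
  rewrite diagonal_sumsE => h.
  apply: (@le_trans _ _ (\sum_(e <- [seq e <- F | e \in E]) inner (P e) e)).
    apply: ler_sum_subset; rewrite ?filter_uniq ?fset_uniq// => x xs.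
    by rewrite mem_filter (mem_set (sE _ xs)) inE/= inE/= xs orbT.
  rewrite -[leLHS]ger0_norm ?sumr_ge0//.
  rewrite -[X in `|X|](subrK tau) addrC; apply: le_trans (ler_normD _ _) _.
  by rewrite lerD2l distrC.
pose t := (C ^+ 2 * `|tau| + 1) / eta.
have n0 : 0 <= C ^+ 2 * `|tau| by rewrite mulr_ge0 ?exprn_ge0 ?(ltW C0).
have t0 : 0 < t by rewrite divr_gt0 ?ltr_wpDl.
have [|F0 _ HF0] := Htau (eta / t / 2); first by rewrite divr_gt0// divr_gt0.
exists F0 => X bX F F0F.
have [s [us sE] Hs] := diagonal_sums_split E P F0F.
rewrite Hs addrC addKr -(ler_pM2l (ltr0Sn K 1)).
apply: le_trans (sum_inner_le HK bE bA tauP (ltW C0) bX us sE t0) _.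
rewrite mulr2n mulrDl mul1r; apply: lerD.
  rewrite -ler_pdivlMl// mulrC -/P -[leLHS]ger0_norm ?sumr_ge0//.
  have -> : \sum_(e <- s) inner (P e) e =
     (tau - diagonal_sums E P F0) - (tau - diagonal_sums E P F).
    by rewrite Hs; ring.
  apply: le_trans (ler_normB _ _) _; rewrite [leRHS]splitr; apply: lerD.
    by apply: HF0 => /=.
  exact: HF0.
rewrite /t invf_div mulrAC ler_pdivrMr ?ltr_wpDl// ler_wpM2l ?(ltW eta0)//.
by rewrite lerDl.
Qed.

Lemma diagonal_sums_cvg (C : K) X : 0 < C -> bounded_by C X ->
  diagonal_sums E (X \o A) @ totally --> (trace E (X \o A) : K^o).
Proof.
move=> C0 bX; suff : cvg (diagonal_sums E (X \o A) @ totally) by [].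
have [[e Ee]|E0] := pselect (exists e, E e).
  have [oE _] := bE; apply: (scalar_cvg (orthonormal_norm oE Ee)) => eps eps0.
  have [F0 HF0] := uniform_tails C0 eps0.
  exists (diagonal_sums E (X \o A) F0); exists F0 => // F F0F.
  by rewrite distrC; exact: HF0.
have -> : diagonal_sums E (X \o A) = fun=> 0.
  apply/funext => F; rewrite diagonal_sumsE big_seq big1// => e.
  by rewrite mem_filter => /andP[/set_mem Ee]; have := E0 (ex_intro _ e Ee).
exact: is_cvg_cst.
Qed.

(** The limit of [uniform_tails] along the finite sets [F]. *)
Lemma trace_tail (C eta : K) : 0 < C -> 0 < eta ->
  exists F0 : {fset U}, forall X, bounded_by C X ->
    `|trace E (X \o A) - diagonal_sums E (X \o A) F0| <= eta.
Proof.
move=> C0 eta0; have [F0 HF0] := uniform_tails C0 eta0; exists F0 => X bX.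
apply: (@cvg_norm_le K K^o _ totally _ _ _ _ (cvgB (diagonal_sums_cvg C0 bX)
  (cvg_cst (diagonal_sums E (X \o A) F0)))).
exists F0 => // F F0F; exact: HF0.
Qed.
End TraceClass.

Lemma sum_cvg (I : Type) (F : set_system I) {FF : Filter F} (s : seq U)
    (f : I -> U -> K) (l : U -> K) :
  (forall e, (fun i => f i e : K^o) @ F --> (l e : K^o)) ->
  (fun i => \sum_(e <- s) f i e : K^o) @ F --> (\sum_(e <- s) l e : K^o).
Proof.
move=> fl; elim: s => [|e s IH].
  by under eq_fun do rewrite big_nil; rewrite big_nil; exact: cvg_cst.
under eq_fun do rewrite big_cons; rewrite big_cons.
exact: (@cvgD _ K^o _ _ _ _ _ _ _ (fl e) IH).
Qed.

(** Up to [eta / 3], uniformly in [i], the traces are the sums over the finite set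
    [F0], which converge termwise. *)
Lemma strong_weakstar_cvg (I : Type) (F : set_system I) {FF : Filter F}
    (C : K) (T_ : I -> U -> U) (T : U -> U) :
  0 < C -> (forall i, bounded_by C (T_ i)) -> bounded_operator T ->
  (forall x, T_ i x @[i --> F] --> T x) -> weakstar_cvg F T_ T.
Proof.
move=> C0 bT_ bT cT; split=> //; first by move=> i; exact: bounded_by_operator (bT_ i).
move=> E A bE tA; have /bounded_operatorP[D D0 [lT nT]] := bT.
have CD0 : 0 < C + D by rewrite addr_gt0.
have bT' : bounded_by (C + D) T.
  by split=> // x; apply: le_trans (nT x) _; rewrite ler_wpM2r// lerDr ltW.
have bT_' i : bounded_by (C + D) (T_ i).
  have [l n] := bT_ i.
  by split=> // x; apply: le_trans (n x) _; rewrite ler_wpM2r// lerDl ltW.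
apply/cvgrPdist_le => eta eta0.
have eta3 : 0 < eta / 3 by rewrite divr_gt0.
have [F0 HF0] := trace_tail bE tA CD0 eta3.
have : (fun i => diagonal_sums E (T_ i \o A) F0 : K^o) @ F -->
       (diagonal_sums E (T \o A) F0 : K^o).
  rewrite diagonal_sumsE; under eq_fun do rewrite diagonal_sumsE.
  by apply: sum_cvg => e; exact: (inner_cvg HK e (cT (A e))).
move=> /cvgrPdist_le /(_ _ eta3) H; near=> i.
have -> : trace E (T \o A) - trace E (T_ i \o A) =
  (trace E (T \o A) - diagonal_sums E (T \o A) F0) +
  (diagonal_sums E (T \o A) F0 - diagonal_sums E (T_ i \o A) F0) -
  (trace E (T_ i \o A) - diagonal_sums E (T_ i \o A) F0) by ring.
have -> : eta = eta / 3 + eta / 3 + eta / 3 by field.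
apply: le_trans (ler_normB _ _) _; apply: lerD; last exact: HF0.
apply: le_trans (ler_normD _ _) _; apply: lerD; first exact: HF0.
by near: i.
Unshelve. all: by end_near. Qed.
End WeakStar.

(** * Partial sums over windows of integers *)

Section PartialSums.
Variable J : set int.
Implicit Types n m : nat * nat.

Definition window n : seq int := fset_set (J `&` [set j : int | - n.1%:Z <= j <= n.2%:Z]).

Lemma window_finite n : finite_set (J `&` [set j : int | - n.1%:Z <= j <= n.2%:Z]).
Proof.
apply: (@sub_finite_set _ _ ((fun k : nat => k%:Z - n.1%:Z) @` `I_(n.1 + n.2).+1)).
  move=> j [_ /= /andP[h1 h2]]; exists (absz (j + n.1%:Z)).
    by rewrite /=; lia.
  by lia.
exact: finite_image (finite_II _).
Qed.

Lemma mem_window n j : (j \in window n) = (j \in J) && (- n.1%:Z <= j <= n.2%:Z).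
Proof.
rewrite /window in_fset_set; last exact: window_finite.
by rewrite in_setI; congr (_ && _); rewrite mem_setE.
Qed.

Lemma window_uniq n : uniq (window n).
Proof. exact: fset_uniq. Qed.

Lemma window_sub n m : (n.1 <= m.1)%N -> (n.2 <= m.2)%N -> {subset window n <= window m}.
Proof. by move=> h1 h2 j; rewrite !mem_window => /andP[-> /=]; lia. Qed.

Lemma partial_sumsE (M : nmodType) (F : int -> M) n :
  partial_sums J F n = \sum_(j <- window n) F j.
Proof. by rewrite /partial_sums fsbig_finite//; exact: window_finite. Qed.

Lemma both_ends_ge n : both_ends [set m | (n.1 <= m.1)%N && (n.2 <= m.2)%N].
Proof.
exists ([set k | (n.1 <= k)%N], [set k | (n.2 <= k)%N]) => /=.
  by split; [exists n.1|exists n.2].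
by move=> [a b] [/= h1 h2]; rewrite h1 h2.
Qed.
End PartialSums.

#[local] Instance both_ends_proper : ProperFilter both_ends.
Proof. exact: filter_prod_proper. Qed.

(** * The frame operator *)

Section FrameOperator.
Variables (K : numFieldType) (conj : K -> K).
Hypothesis HK : scalar_axioms conj.
Variables (U : hilbertType conj) (J : set int) (V : int -> hilbertType conj).
Variables (L : forall j, U -> V j) (A B : K).
Hypotheses (bL : forall j, J j -> bounded_operator (L j)) (A0 : 0 < A) (B0 : 0 < B).
Hypothesis frameL : forall f : U, exists2 s : K,
  partial_sums J (fun j => `|L j f| ^+ 2 : K^o) @ both_ends --> (s : K^o) &
  A * `|f| ^+ 2 <= s <= B * `|f| ^+ 2.
Implicit Types (f g : U) (n m : nat * nat).

Local Notation w := (window J).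
Local Notation S := (frame_operator J L).

Definition partial_frame n f : U := \sum_(j <- w n) adjoint (L j) (L j f).

Lemma windowJ n j : j \in w n -> J j.
Proof. by rewrite mem_window => /andP[/set_mem]. Qed.

Lemma frame_sum_le_lim f s n :
  partial_sums J (fun j => `|L j f| ^+ 2 : K^o) @ both_ends --> (s : K^o) -> 0 <= s ->
  \sum_(j <- w n) `|L j f| ^+ 2 <= s.
Proof.
move=> /cvgrPdist_le Hs s0; apply/ler_addgt0Pr => e e0.
have [m [/andP[h1 h2] /= hm]] := filter_ex (filterI (both_ends_ge n) (Hs e e0)).
rewrite partial_sumsE in hm.
apply: (@le_trans _ _ (\sum_(j <- w m) `|L j f| ^+ 2)).
  apply: ler_sum_subset; rewrite ?window_uniq//.
  exact: window_sub.
rewrite -lerBlDl; apply: le_trans hm; rewrite distrC; apply: real_ler_norm.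
by rewrite rpredB// ger0_real// sumr_ge0// => j _; rewrite exprn_ge0.
Qed.

Lemma frame_sum_le f n : \sum_(j <- w n) `|L j f| ^+ 2 <= B * `|f| ^+ 2.
Proof.
have [s cs /andP[h1 h2]] := frameL f; apply: le_trans (frame_sum_le_lim n cs _) h2.
by apply: le_trans h1; rewrite mulr_ge0 ?exprn_ge0 ?(ltW A0).
Qed.

(** For [g] the sum on the left, [|g|^2] is the sum of [<L_j f, L_j g>]; by
    [young_le] with weight [B], twice this is at most [B] times the sum of
    [|L_j f|^2] plus [B^-1] times that of [|L_j g|^2], and the latter is at most
    [|g|^2]. *)
Lemma synthesis_le f n (P : pred int) :
  `|\sum_(j <- w n | P j) adjoint (L j) (L j f)| ^+ 2 <=
  B * \sum_(j <- w n | P j) `|L j f| ^+ 2.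
Proof.
set g := \sum_(j <- _ | _) _.
have gE : `|g| ^+ 2 = \sum_(j <- w n | P j) inner (L j f) (L j g).
  rewrite -inner_norm {1}/g inner_suml big_seq_cond [RHS]big_seq_cond.
  apply: eq_bigr => j /andP[/windowJ jJ _]; rewrite adjointPr//; exact: bL.
have g2 : 2 * `|g| ^+ 2 <= B * \sum_(j <- w n | P j) `|L j f| ^+ 2 + `|g| ^+ 2.
  rewrite -[X in 2 * X]ger0_norm ?exprn_ge0// [X in 2 * `|X|]gE.
  apply: (@le_trans _ _ (\sum_(j <- w n | P j) (B * `|L j f| ^+ 2 + B^-1 * `|L j g| ^+ 2))).
    apply: (@le_trans _ _ (2 * \sum_(j <- w n | P j) `|inner (L j f) (L j g)|)).
      by rewrite ler_wpM2l// ler_norm_sum.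
    rewrite mulr_sumr; apply: ler_sum => j _.
    apply: (@le_trans _ _ (2 * (`|L j f| * `|L j g|))); last exact: young_le.
    by rewrite ler_wpM2l// (inner_norm_le HK).
  rewrite big_split /= -!mulr_sumr lerD2l ler_pdivrMl//.
  apply: le_trans (frame_sum_le g n); rewrite big_mkcond /=.
  by apply: ler_sum => j _; case: ifP => // _; rewrite exprn_ge0.
by move: g2; rewrite mulr2n mulrDl mul1r lerD2r.
Qed.

Lemma partial_frame_bounded n : bounded_by B (partial_frame n).
Proof.
split=> [a f g|f].
  rewrite /partial_frame scaler_sumr -big_split big_seq [RHS]big_seq.
  apply: eq_bigr => j /windowJ jJ; have bLj := bL jJ.
  have [l _] := bounded_comp (adjoint_bounded HK bLj) bLj; exact: l.
apply: ler_of_sqr; rewrite ?mulr_ge0 ?(ltW B0)//.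
apply: le_trans (synthesis_le f n xpredT) _.
by rewrite exprMn expr2 -mulrA ler_pM2l// frame_sum_le.
Qed.

Lemma partial_frame_selfadjoint n : selfadjoint (partial_frame n).
Proof.
move=> f g; rewrite /partial_frame inner_suml inner_sumr big_seq [RHS]big_seq.
by apply: eq_bigr => j /windowJ jJ; rewrite (adjointPr HK (bL jJ)) -(adjointP HK (bL jJ)).
Qed.

(** For a window [m] containing [N], [synthesis_le] bounds the squared distance of
    the two partial sums by [B] times a tail of the convergent sum of
    [|L_j f|^2]. *)
Lemma partial_frame_cvg f : partial_frame n f @[n --> both_ends] --> S f.
Proof.
have -> : (fun n => partial_frame n f) = partial_sums J (fun j => adjoint (L j) (L j f)).
  by apply/funext => n; rewrite partial_sumsE.
rewrite /frame_operator; set x := partial_sums _ _; suff : cvg (x @ both_ends) by [].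
apply: cauchy_cvg; apply: cauchy_exP => eps eps0.
have [s cs /andP[h1 _]] := frameL f.
have s0 : 0 <= s by apply: le_trans h1; rewrite mulr_ge0 ?exprn_ge0 ?(ltW A0).
have eps2 : 0 < eps / 2 by rewrite divr_gt0.
have d0 : 0 < (eps / 2) ^+ 2 / B by rewrite divr_gt0 ?exprn_gt0.
have /cvgrPdist_le /(_ _ d0) H := cs.
have [N /= HN] := filter_ex H.
exists (x N); rewrite /= nbhs_simpl; apply: filterS (both_ends_ge N) => m /andP[m1 m2].
rewrite -ball_normE /=; apply: (@le_lt_trans _ _ (eps / 2)); last first.
  by rewrite ltr_pdivrMr// ltr_pMr// ltr1n.
rewrite /x !partial_sumsE.
rewrite (sum_subset_split _ (window_uniq J N) (window_uniq J m) (window_sub m1 m2)).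
rewrite opprD addrA subrr sub0r normrN; apply: ler_of_sqr; rewrite ?(ltW eps2)//.
apply: le_trans (synthesis_le f m _) _; rewrite -ler_pdivlMl// mulrC.
have := frame_sum_le_lim m cs s0.
rewrite (sum_subset_split _ (window_uniq J N) (window_uniq J m) (window_sub m1 m2)).
rewrite addrC -lerBrDr => h; apply: le_trans h _; rewrite partial_sumsE in HN.
apply: le_trans HN; apply: real_ler_norm.
by rewrite rpredB// ger0_real// sumr_ge0// => j _; rewrite exprn_ge0.
Qed.
Arguments partial_frame_cvg : clear implicits.

Lemma frame_operator_bounded : bounded_by B S.
Proof.
split=> [a f g|f].
  apply: (@lim_ext K U _ both_ends _ _ _ _ _ (partial_frame_cvg _)
    (cvgD (cvgZr (k := a) (partial_frame_cvg f)) (partial_frame_cvg g))).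
  by move=> n; have [-> _] := partial_frame_bounded n.
apply: (@cvg_norm_le K U _ _ _ _ _ _ (partial_frame_cvg f)); apply: nearW => n.
by have [_ h] := partial_frame_bounded n; exact: h.
Qed.

Lemma frame_operator_selfadjoint : selfadjoint S.
Proof.
move=> x y; apply: (@lim_ext K K^o _ both_ends _ _ _ _ _
  (inner_cvg HK y (partial_frame_cvg x)) (inner_cvgr HK x (partial_frame_cvg y))) => n.
exact: partial_frame_selfadjoint.
Qed.

(** [<S f, f>] is the sum of [|L_j f|^2]. *)
Lemma frame_operator_coercive f : A * `|f| ^+ 2 <= inner (S f) f.
Proof.
have [s cs /andP[h1 _]] := frameL f; apply: le_trans h1 _; rewrite le_eqVlt.
apply/orP; left; apply/eqP.
apply: (@lim_ext K K^o _ both_ends _ _ _ _ _ cs (inner_cvg HK f (partial_frame_cvg f))) => n.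
rewrite partial_sumsE /partial_frame inner_suml big_seq [RHS]big_seq.
by apply: eq_bigr => j /windowJ jJ; rewrite (adjointPr HK (bL jJ)) inner_norm.
Qed.

Let bS : bounded_operator S := bounded_by_operator frame_operator_bounded.
Let sS := frame_operator_selfadjoint.
Let cS := frame_operator_coercive.
Local Notation S' := (inverse_operator S).

Lemma adjoint_canonical_dual j : J j ->
  adjoint (canonical_dual J L j) = S' \o adjoint (L j).
Proof.
move=> jJ; apply: adjoint_eq => x y; rewrite /canonical_dual /= (adjointP HK (bL jJ)).
exact: (inverse_selfadjoint HK bS sS A0 cS).
Qed.
End FrameOperator.

Theorem mainTheorem3 (R : realType) (K : numFieldType) (conj : K -> K)
    (RorC : hilbert_scalars R conj)
    (U : hilbertType conj) (J : set int) (V : int -> hilbertType conj)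
    (L : forall j : int, U -> V j) (L_gframe : gframe J L)
    (T : U -> U) (T_bounded : bounded_operator T) :
  let L' := canonical_dual J L in
  [/\ weakstar_series J (fun j => T \o adjoint (L j) \o L' j) T,
      weakstar_series J (fun j => T \o adjoint (L' j) \o L j) T,
      weakstar_series J (fun j => adjoint (L j) \o L' j \o T) T &
      weakstar_series J (fun j => adjoint (L' j) \o L j \o T) T].
Proof.
move=> L'; have HK := hilbert_scalars_axioms RorC.
have [bL [A [B [A0 B0 frameL]]]] := L_gframe.
have bX := partial_frame_bounded HK bL A0 B0 frameL.
have cX := partial_frame_cvg HK bL A0 B0 frameL.
have bS := frame_operator_bounded HK bL A0 B0 frameL.
have sS := frame_operator_selfadjoint HK bL A0 B0 frameL.
have cS := frame_operator_coercive HK bL A0 B0 frameL.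
have bS' := inverse_bounded_by HK (bounded_by_operator bS) sS A0 cS.
have SK := inverse_operatorK HK (bounded_by_operator bS) sS A0 cS.
have S'K := operatorK HK (bounded_by_operator bS) sS A0 cS.
have adjL' := adjoint_canonical_dual HK bL A0 B0 frameL.
set S := frame_operator J L in bS sS cS bS' SK S'K adjL' cX.
set S' := inverse_operator S in bS' SK S'K adjL'.
have /bounded_operatorP[C C0 bT] := T_bounded.
have bounded_S' := bounded_by_operator bS'.
have A'0 : 0 < A^-1 by rewrite invr_gt0.
have lT := bT.1; have lS' := bS'.1.
have e1 n : partial_sums J (fun j => T \o adjoint (L j) \o L' j) n =
    T \o (partial_frame J L n \o S').
  by rewrite partial_sumsE; apply/funext => x; rewrite fct_sumE /= (linop_sum lT).
have e2 n : partial_sums J (fun j => T \o adjoint (L' j) \o L j) n =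
    T \o (S' \o partial_frame J L n).
  rewrite partial_sumsE; apply/funext => x; rewrite fct_sumE /= (linop_sum lS') (linop_sum lT).
  by rewrite big_seq [RHS]big_seq; apply: eq_bigr => j /windowJ jJ; rewrite /L' /= adjL'.
have e3 n : partial_sums J (fun j => adjoint (L j) \o L' j \o T) n =
    (partial_frame J L n \o S') \o T.
  by rewrite partial_sumsE; apply/funext => x; rewrite fct_sumE.
have e4 n : partial_sums J (fun j => adjoint (L' j) \o L j \o T) n =
    (S' \o partial_frame J L n) \o T.
  rewrite partial_sumsE; apply/funext => x; rewrite fct_sumE /= (linop_sum lS').
  by rewrite big_seq [RHS]big_seq; apply: eq_bigr => j /windowJ jJ; rewrite /L' /= adjL'.
have bXS' n := bounded_by_comp (ltW B0) (bX n) bS'.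
have bS'X n := bounded_by_comp (ltW A'0) bS' (bX n).
have cXS' x : (partial_frame J L n \o S') x @[n --> both_ends] --> x.
  by rewrite -[X in _ --> X]SK; exact: cX.
have cS'X x : (S' \o partial_frame J L n) x @[n --> both_ends] --> x.
  by rewrite -[X in _ --> X]S'K; exact: (bounded_cvg bounded_S' (cX x)).
split.
- apply: (strong_weakstar_cvg HK (C := C * (B * A^-1))) => //.
  + by rewrite !mulr_gt0.
  + by move=> n; rewrite e1; exact: bounded_by_comp (ltW C0) bT (bXS' n).
  + move=> x; under eq_fun do rewrite e1; exact: (bounded_cvg T_bounded (cXS' x)).
- apply: (strong_weakstar_cvg HK (C := C * (A^-1 * B))) => //.
  + by rewrite !mulr_gt0.
  + by move=> n; rewrite e2; exact: bounded_by_comp (ltW C0) bT (bS'X n).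
  + move=> x; under eq_fun do rewrite e2; exact: (bounded_cvg T_bounded (cS'X x)).
- apply: (strong_weakstar_cvg HK (C := (B * A^-1) * C)) => //.
  + by rewrite !mulr_gt0.
  + by move=> n; rewrite e3; apply: bounded_by_comp (bXS' n) bT; rewrite ltW// mulr_gt0.
  + by move=> x; under eq_fun do rewrite e3; exact: cXS'.
- apply: (strong_weakstar_cvg HK (C := (A^-1 * B) * C)) => //.
  + by rewrite !mulr_gt0.
  + by move=> n; rewrite e4; apply: bounded_by_comp (bS'X n) bT; rewrite ltW// mulr_gt0.
  + by move=> x; under eq_fun do rewrite e4; exact: cS'X.
Qed.
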